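(* For every integer $N\ge2$, $$MT(N,\beta_N,1)=\sup_{u\in W^{1,N}(\mathbb{R}^N),\ \|u\|_{W^{1,N}(\mathbb{R}^N)}\le1}\int_{\mathbb{R}^N}\Phi_N\Big(\beta_N(1+\|u\|_N^N)^{\frac1{N-1}}|u|^{\frac N{N-1}}\Big)dx=\infty .$$
   Context: $\|\cdot\|_N$ denotes the $L^N(\mathbb{R}^N)$ norm, $\|u\|_{W^{1,N}(\mathbb{R}^N)}=(\|\nabla u\|_N^N+\|u\|_N^N)^{1/N}$, $\omega_{N-1}$ is the surface area of the unit sphere in $\mathbb{R}^N$, $\beta_N=N\omega_{N-1}^{1/(N-1)}$, and $\Phi_N(t)=e^t-\sum_{k=0}^{N-2}\frac{t^k}{k!}$ for $t\ge0$. *)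

(* Defs.v *)
From HB Require Import structures.
From mathcomp Require Import all_boot all_order all_algebra.
From mathcomp Require Import all_classical all_reals all_analysis.
Set Implicit Arguments.
Unset Strict Implicit.
Unset Printing Implicit Defensive.
Import Order.TTheory GRing.Theory Num.Theory.
Import numFieldNormedType.Exports.
Local Open Scope classical_set_scope.
Local Open Scope ring_scope.

(* R^n is 'rV[R]_n, with the product of the Borel sigma-algebras of R. The     *)
(* norm `|x| that the library puts on 'rV[R]_n is the sup norm: it is only     *)
(* used through its topology; Euclidean lengths are written enorm below.       *)

Section measurable_rV.
Context (R : realType) (n : nat).

Let coord (i : 'I_n) (x : 'rV[R]_n) : measurableTypeR R := x ord0 i.

Let rV_set0 : g_sigma_preimage coord set0.
Proof. exact: sigma_algebra0. Qed.

Let rV_setC A : g_sigma_preimage coord A -> g_sigma_preimage coord (~` A).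
Proof. exact: sigma_algebraC. Qed.

Let rV_bigcup (F : (set 'rV[R]_n)^nat) :
  (forall i, g_sigma_preimage coord (F i)) ->
  g_sigma_preimage coord (\bigcup_i (F i)).
Proof. exact: sigma_algebra_bigcup. Qed.

HB.instance Definition _ := @isMeasurable.Build default_measure_display
  'rV[R]_n (g_sigma_preimage coord) rV_set0 rV_setC rV_bigcup.

Lemma measurable_rV_coord (i : 'I_n) :
  measurable_fun [set: 'rV[R]_n] (fun x => x ord0 i : measurableTypeR R).
Proof.
move=> _ Y mY; rewrite setTI; apply: sub_sigma_algebra => /=.
rewrite -bigcup_seq/=; exists i => /=; first by rewrite mem_index_enum.
by exists Y => //; rewrite setTI.
Qed.

Lemma measurable_fun_rVP d (T : measurableType d) (f : T -> 'rV[R]_n) :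
  (forall i, measurable_fun [set: T] (fun t => f t ord0 i : measurableTypeR R)) ->
  measurable_fun [set: T] f.
Proof.
move=> mf; suff h : g_sigma_preimage coord `<=`
    [set A | measurable (f @^-1` A)].
  by move=> _ A mA; rewrite setTI; exact: h.
apply: smallest_sub.
  split => /=.
  - by rewrite preimage_set0.
  - by move=> A mA; rewrite setTD preimage_setC; exact: measurableC.
  - by move=> F mF; rewrite preimage_bigcup; exact: bigcupT_measurable.
rewrite -bigcup_seq/=; apply: bigcup_sub => i _ _ [B mB <-] /=.
rewrite setTI.
have := mf i measurableT B mB; rewrite setTI; exact.
Qed.

End measurable_rV.

Section lebesgue_rV.
Context (R : realType).

Definition cons_rV n (p : measurableTypeR R * 'rV[R]_n) : 'rV[R]_n.+1 :=
  row_mx (p.1)%:M p.2.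

Lemma cons_rV0 n p : @cons_rV n p ord0 ord0 = p.1.
Proof.
rewrite /cons_rV (_ : ord0 = lshift n (ord0 : 'I_1)); last exact: val_inj.
by rewrite (row_mxEl (p.1)%:M) !mxE eqxx mulr1n.
Qed.

Lemma cons_rVS n p (i : 'I_n) : cons_rV p ord0 (lift ord0 i) = p.2 ord0 i.
Proof.
rewrite /cons_rV (_ : lift ord0 i = rshift 1 i); last exact: val_inj.
by rewrite (row_mxEr (p.1)%:M).
Qed.

Lemma measurable_cons_rV n : measurable_fun [set: _] (@cons_rV n).
Proof.
apply: measurable_fun_rVP => i.
case: (unliftP ord0 i) => [j|] ->.
  under eq_fun do rewrite cons_rVS.
  apply: (measurableT_comp (measurable_rV_coord j)); exact: measurable_snd.
under eq_fun do rewrite cons_rV0.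
exact: measurable_fst.
Qed.

Section step.
Context n (mu : {sigma_finite_measure set 'rV[R]_n -> \bar R}).

Definition lebesgue_cons : set 'rV[R]_n.+1 -> \bar R :=
  pushforward (lebesgue_measure \x mu)%E (@cons_rV n).

Let lebesgue_cons0 : lebesgue_cons set0 = 0%E.
Proof. by rewrite /lebesgue_cons /pushforward preimage_set0 measure0. Qed.

Let lebesgue_cons_ge0 A : (0 <= lebesgue_cons A)%E.
Proof. by rewrite /lebesgue_cons /pushforward measure_ge0. Qed.

Let lebesgue_cons_sigma_additive : semi_sigma_additive lebesgue_cons.
Proof.
move=> F mF tF mUF; rewrite /lebesgue_cons /pushforward preimage_bigcup.
have mc := @measurable_cons_rV n.
apply: measure_semi_sigma_additive.
- by move=> k; rewrite -[X in measurable X]setTI; exact: mc.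
- apply/trivIsetP => /= i j _ _ ij; rewrite -preimage_setI.
  by move/trivIsetP : tF => /(_ _ _ _ _ ij) ->//; rewrite preimage_set0.
- by rewrite -preimage_bigcup -[X in measurable X]setTI; exact: mc.
Qed.

HB.instance Definition _ := isMeasure.Build _ _ _ lebesgue_cons
  lebesgue_cons0 lebesgue_cons_ge0 lebesgue_cons_sigma_additive.

Let lebesgue_cons_sigma_finite : sigma_finite setT lebesgue_cons.
Proof.
have /sigma_finiteP[F [TF ndF Foo]] := sigma_finiteT (@lebesgue_measure R).
have /sigma_finiteP[G [TG ndG Goo]] := sigma_finiteT mu.
pose g (x : 'rV[R]_n.+1) : measurableTypeR R * 'rV[R]_n :=
  (x ord0 ord0, \row_i x ord0 (lift ord0 i)).
have mg : measurable_fun setT g.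
  apply/measurable_fun_pair; first exact: measurable_rV_coord.
  apply: measurable_fun_rVP => i.
  under eq_fun do rewrite mxE.
  exact: measurable_rV_coord.
have gK : cancel (@cons_rV n) g.
  move=> [a v]; rewrite /g cons_rV0; congr pair.
  by apply/rowP => i; rewrite mxE cons_rVS.
exists (fun k => g @^-1` (F k `*` G k)).
  apply/esym; rewrite -subTset => x _.
  have [i _ Fi] : (\bigcup_k F k) (g x).1 by rewrite -TF.
  have [j _ Gj] : (\bigcup_k G k) (g x).2 by rewrite -TG.
  exists (maxn i j) => //; split.
    by move: Fi; exact/subsetPset/ndF/leq_maxl.
  by move: Gj; exact/subsetPset/ndG/leq_maxr.
move=> k; have [mF Fk] := Foo k; have [mG Gk] := Goo k.
have mFG : measurable (F k `*` G k) by exact: measurableX.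
split; first by rewrite -[X in measurable X]setTI; exact: mg.
rewrite /lebesgue_cons /pushforward.
rewrite (_ : _ @^-1` _ = F k `*` G k); last first.
  by rewrite -comp_preimage (_ : g \o _ = id)//; apply/funext => p; exact: gK.
by rewrite product_measure1E// lte_mul_pinfty// ge0_fin_numE.
Qed.

HB.instance Definition _ := Measure_isSigmaFinite.Build _ _ _ lebesgue_cons
  lebesgue_cons_sigma_finite.

End step.

Fixpoint lebesgue_rV n : {sigma_finite_measure set 'rV[R]_n -> \bar R} :=
  match n with
  | 0 => \d_(0 : 'rV[R]_0)
  | m.+1 => lebesgue_cons (lebesgue_rV m)
  end.

End lebesgue_rV.

Section euclidean.
Context (R : realType) (N : nat).
Local Notation Rn := 'rV[R]_N.

Definition enorm (x : Rn) : R := Num.sqrt (\sum_(i < N) x ord0 i ^+ 2).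

Definition unit_sphere : set Rn := [set x | enorm x = 1].

Definition unit_cone (A : set Rn) : set Rn :=
  [set x | 0 < enorm x <= 1 /\ A ((enorm x)^-1 *: x)].

(* Surface measure on the unit sphere, normalized as in the polar coordinates  *)
(* formula: sigma(A) = N * |{x : 0 < |x| <= 1, x / |x| in A}|.                  *)
Definition surface_measure (A : set Rn) : \bar R :=
  (N%:R%:E * lebesgue_rV R N (unit_cone A))%E.

(* This is omega_{N-1}. *)
Definition sphere_area : R := fine (surface_measure unit_sphere).

End euclidean.

Section sobolev.
Context (R : realType) (N : nat).
Local Notation Rn := 'rV[R]_N.
Local Notation mu := (lebesgue_rV R N).

Definition partial (i : 'I_N) (f : Rn -> R) : Rn -> R :=
  'D_(delta_mx ord0 i) f.

Definition iter_partial (s : seq 'I_N) (f : Rn -> R) : Rn -> R :=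
  foldr partial f s.

Definition smooth (f : Rn -> R) : Prop :=
  forall s : seq 'I_N, continuous (iter_partial s f) /\
    forall (x : Rn) (i : 'I_N), derivable (iter_partial s f) x (delta_mx ord0 i).

Definition test_function (phi : Rn -> R) : Prop :=
  smooth phi /\ compact (closure [set x | phi x != 0]).

Definition weak_partial (i : 'I_N) (u v : Rn -> R) : Prop :=
  forall phi : Rn -> R, test_function phi ->
    \int[mu]_x (u x * partial i phi x) = - \int[mu]_x (v x * phi x).

(* Functions are Borel representatives. The weak gradient of u is determined   *)
(* by u almost everywhere, so carrying it as a field adds no information.      *)
Record W1N := {
  W1N_fun :> Rn -> R ;
  W1N_grad : 'I_N -> Rn -> R ;
  W1N_fun_Lfun : W1N_fun \in Lfun mu N%:R%:E ;
  W1N_grad_Lfun : forall i, W1N_grad i \in Lfun mu N%:R%:E ;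
  W1N_weak_grad : forall i, weak_partial i W1N_fun (W1N_grad i)
}.

Definition LN_norm (f : Rn -> R) : \bar R := 'N[mu]_(N%:R%:E)[EFin \o f]%E.

Definition grad_norm (u : W1N) (x : Rn) : R :=
  enorm (\row_(i < N) W1N_grad u i x).

Definition W1N_norm (u : W1N) : \bar R :=
  ((LN_norm (grad_norm u) `^ N%:R + LN_norm u `^ N%:R) `^ (N%:R^-1))%E.

End sobolev.

Section moser_trudinger.
Context (R : realType) (N : nat).
Local Notation Rn := 'rV[R]_N.
Local Notation mu := (lebesgue_rV R N).

Definition betaN : R := N%:R * sphere_area R N `^ (N.-1%:R^-1).

Definition Phi (t : R) : R := expR t - \sum_(k < N.-1) t ^+ k / k`!%:R.

Definition MT_functional (beta alpha : R) (u : W1N R N) : \bar R :=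
  (\int[mu]_x
    (Phi (beta * (1 + alpha * fine (LN_norm u) ^+ N) `^ (N.-1%:R^-1)
          * `|u x| `^ (N%:R / N.-1%:R)))%:E)%E.

Definition MT (beta alpha : R) : \bar R :=
  ereal_sup [set MT_functional beta alpha u
            | u in [set u : W1N R N | (W1N_norm u <= 1)%E]].

End moser_trudinger.

(* Main.v *)
Require Import Defs.
From mathcomp Require Import all_boot all_order all_algebra.
From mathcomp Require Import all_classical all_reals all_analysis.
From mathcomp Require Import measurable_realfun.
From mathcomp Require Import ring lra.
Set Implicit Arguments.
Unset Strict Implicit.
Unset Printing Implicit Defensive.
Import Order.TTheory GRing.Theory Num.Theory.
Import numFieldNormedType.Exports.
Local Open Scope classical_set_scope.
Local Open Scope ring_scope.

(** The supremum is infinite because of Moser's concentrating functions, taken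
    with supports that are allowed to be large. Write [omega] for the area of
    the unit sphere, [vol] for the volume of the unit ball, and let [w] be the
    radial function equal to [L] on the core [|x| <= r * exp (- L)], to
    [ln (r / |x|)] on the shell up to radius [r], and to 0 outside.

    The energy [\int |grad w| ^ N] is at most [omega * L]
    ([integral_moser_grad_le]), while [T = \int w ^ N] is bounded by a constant
    that depends on [r] but not on [L] ([integral_moser_le]). Let [u = c * w]
    with [c ^ N * (omega * L + T) = 1]. The full Sobolev norm of [u] is at most
    1, and [tau = ||u||_N ^ N] equals [T / (omega * L + T)]. On the core the
    argument of [Phi] is exactly
    [N * L * ((1 - tau) * (1 + tau)) ^ (1 / (N - 1)) >= N * L * (1 - tau ^ 2)]
    ([moser_exponent_ge]): the factor [1 + tau] cancels the first-order loss
    [1 - tau] due to the normalization. As [tau = O(1 / L)] for fixed [r], the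
    remaining loss [N * L * tau ^ 2] is at most 1 for large [L]. The core has
    volume [vol * r ^ N * exp (- N * L)] and [Phi] is at least
    [exp (N * L - 1) / 2] there, so the functional is at least
    [vol * r ^ N / (2 * e)] ([moser_functional_ge]), and [r] is arbitrary.

    Only the behaviour of Lebesgue measure under [x |-> c * x + h]
    ([lebesgue_rV_affine]) is needed from the theory of integration on [R^n].
    Scaling gives the volumes of balls and shells; the sharp energy bound
    follows by cutting the shell into thin shells, without polar coordinates.
    Translation invariance makes it possible to pass a difference quotient from
    a test function to [w], so that a Lipschitz function that is almost
    everywhere differentiable along an axis has its pointwise derivative as
    weak derivative ([weak_partial_lipschitz]). *)

(** * Lebesgue measure under affine maps *)

Section affine.
Context (R : realType).

Lemma lebesgue_measure_affine (c h : R) (A : set (measurableTypeR R)) :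
  0 < c -> measurable A ->
  lebesgue_measure A =
  (c%:E * lebesgue_measure ((fun t => (c * t + h)%R) @^-1` A))%E.
Proof.
move=> c0 mA; pose f (t : measurableTypeR R) : measurableTypeR R := c * t + h.
have mf : measurable_fun setT f.
  by apply: measurable_funD => //; exact: measurable_funM.
(* The measure structure of a pushforward depends on the measurability of the
   map, so the instance has to be given explicitly. *)
pose m := measure_function_pushforward__canonical__measure_function_Measure
  (@lebesgue_measure R) mf.
pose cn := NngNum (ltW c0).
rewrite (@lebesgue_measure_unique _ (mscale cn m))// => _ [[a b] _ <-] /=.
rewrite /mscale/= /pushforward.
rewrite (_ : f @^-1` _ = `](a - h) / c, (b - h) / c]%classic).
  rewrite !lebesgue_measure_itv/= !lte_fin ltr_pM2r ?invr_gt0// ltrD2r.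
  case: ifPn => ab; last by rewrite mule0.
  by rewrite -!EFinD -EFinM; congr EFin; field; rewrite gt_eqF.
by apply/seteqP; split => t /=; rewrite !in_itv/= /f ltr_pdivrMr// ler_pdivlMr//
  ltrBlDr lerBrDr (mulrC t).
Qed.

Lemma measurable_affine n (c : R) (h : 'rV[R]_n) :
  measurable_fun setT (fun x : 'rV[R]_n => c *: x + h).
Proof.
apply: measurable_fun_rVP => i.
rewrite (_ : (fun _ => _) = (fun x : 'rV[R]_n => c * x ord0 i + h ord0 i)); last first.
  by apply/funext => x; rewrite !mxE.
apply: measurable_funD => //; apply: measurable_funM => //.
exact: measurable_rV_coord.
Qed.

(** By induction on the dimension: the product measure is characterized by its
    values on rectangles, where both sides factor. *)
Lemma lebesgue_rV_affine n (c : R) (h : 'rV[R]_n) (A : set 'rV[R]_n) :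
  0 < c -> measurable A ->
  lebesgue_rV R n A =
  ((c ^+ n)%:E * lebesgue_rV R n ((fun x => (c *: x + h)%R) @^-1` A))%E.
Proof.
move=> c0; pose affine m (h x : 'rV[R]_m) := c *: x + h.
elim: n h A => [|n IH] h A mA.
  rewrite expr0 mul1e; congr (lebesgue_rV R 0 _).
  by apply/seteqP; split => x /=; rewrite [c *: x + h]thinmx0 (thinmx0 x).
rewrite /= /lebesgue_cons /pushforward.
pose h0 := h ord0 ord0; pose h' : 'rV[R]_n := \row_i h ord0 (lift ord0 i).
pose f (p : measurableTypeR R * 'rV[R]_n) : measurableTypeR R * 'rV[R]_n :=
  (c * p.1 + h0, affine _ h' p.2).
have mf : measurable_fun setT f.
  apply/measurable_fun_pair => /=.
    apply: measurable_funD => //; apply: measurable_funM => //.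
  by apply: measurableT_comp; [exact: measurable_affine|exact: measurable_snd].
pose nu := (@lebesgue_measure R \x lebesgue_rV R n)%E.
pose m := measure_function_pushforward__canonical__measure_function_Measure nu mf.
pose cn := NngNum (ltW (exprn_gt0 n.+1 c0)).
have cf : affine _ h \o @cons_rV R n = @cons_rV R n \o f.
  apply/funext => -[t x]; apply/rowP => i /=; rewrite /affine [LHS]mxE.
  have -> : forall (y : 'rV[R]_n.+1) j, (c *: y) ord0 j = c * y ord0 j.
    by move=> *; rewrite mxE.
  case: (unliftP ord0 i) => [j|] ->; last by rewrite !cons_rV0.
  by rewrite !cons_rVS /= !mxE.
rewrite (@product_measure_unique _ _ _ _ _ _ _ (mscale cn m)); last 2 first.
- move=> B C mB mC.
  transitivity ((c ^+ n.+1)%:E * nu (((fun t => (c * t + h0)%R) @^-1` B) `*`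
    (affine _ h' @^-1` C)))%E; first by [].
  rewrite /nu product_measure1E; last 2 first.
  + rewrite -[X in measurable X]setTI.
    suff : measurable_fun setT
      (fun t : measurableTypeR R => (c * t + h0)%R : measurableTypeR R) by exact.
    by apply: measurable_funD => //; exact: measurable_funM.
  + by rewrite -[X in measurable X]setTI; exact: measurable_affine.
  rewrite [RHS](_ : _ =
    ((c%:E * lebesgue_measure ((fun t => (c * t + h0)%R) @^-1` B)) *
     ((c ^+ n)%:E * lebesgue_rV R n (affine _ h' @^-1` C)))%E); last first.
    by congr (_ * _)%E; [exact: lebesgue_measure_affine|exact: IH].
  rewrite exprS EFinM !muleA; congr (_ * _)%E.
  by rewrite -!muleA; congr (_ * _)%E; rewrite muleC.
- by rewrite -[X in measurable X]setTI; exact: measurable_cons_rV.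
- transitivity ((c ^+ n.+1)%:E * nu ((@cons_rV R n \o f) @^-1` A))%E; first by [].
  by rewrite -cf.
Qed.

End affine.

(** * Measurability of continuous functions *)

Section measurability.
Context (R : realType) (n : nat).
Implicit Types A : set 'rV[R]_n.

(** An open set is the union of the cubes with rational centre and half-side
    [1 / k.+1] that it contains, and there are countably many of these. *)
Lemma open_measurable_rV A : open A -> measurable A.
Proof.
move=> oA.
pose C (qk : 'rV[rat]_n * nat) : set 'rV[R]_n :=
  \bigcap_(i in [set: 'I_n]) [set y | y ord0 i \in
    `](ratr (qk.1 ord0 i) - qk.2.+1%:R^-1), (ratr (qk.1 ord0 i) + qk.2.+1%:R^-1)[ ].
pose F qk := if pselect (C qk `<=` A) then C qk else set0.
have -> : A = \bigcup_qk F qk.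
  apply/seteqP; split => [x Ax|x [qk _]]; last first.
    by rewrite /F; case: pselect => // CA /CA.
  have /nbhs_ballP[e/= e0 xeA] := open_nbhs_nbhs (conj oA Ax).
  have /ltr_add_invr[k] : 0 < e / 2 by rewrite divr_gt0.
  rewrite add0r => ke; have k0 : 0 < k.+1%:R^-1 :> R by rewrite invr_gt0.
  have /choice[q qx] : forall i : 'I_n, exists q : rat,
      ratr q \in `](x ord0 i - k.+1%:R^-1), (x ord0 i + k.+1%:R^-1)[.
    by move=> i; apply/rat_in_itvoo; rewrite ltrD2l gtrN.
  exists (\row_i q i, k) => //; rewrite /F.
  case: pselect => [_ i _|].
    have := qx i; rewrite /= mxE !in_itv/=.
    by move: (k.+1%:R^-1) ke k0 => u ke k0 /andP[? ?]; apply/andP; lra.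
  move=> nCA; exfalso; apply: nCA => y Cy; apply: xeA; split => // i0 i.
  rewrite (ord1 i0); have := Cy i Logic.I; have := qx i.
  rewrite /= mxE !in_itv/=.
  move: (k.+1%:R^-1) ke k0 => u ke k0 /andP[? ?] /andP[? ?].
  by rewrite /ball/= ltr_norml; apply/andP; lra.
apply: countable_bigcupT_measurable => [|qk]; first exact: countableP.
rewrite /F; case: ifP => _ //; apply: fin_bigcap_measurable => // i _.
have := @measurable_rV_coord R n i measurableT
  `](ratr (qk.1 ord0 i) - qk.2.+1%:R^-1),
    (ratr (qk.1 ord0 i) + qk.2.+1%:R^-1)[%classic.
by rewrite setTI; apply; exact: measurable_itv.
Qed.

Lemma continuous_measurable_rV (f : 'rV[R]_n -> R) :
  continuous f -> measurable_fun setT f.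
Proof.
move=> /continuousP cf; apply: (measurability _ (RGenOpens.measurableE R)).
move=> _ [_ [a [b ->] <-]]; rewrite setTI; apply: open_measurable_rV.
exact/cf/interval_open.
Qed.

End measurability.

(** * The Euclidean norm *)

Section euclidean_norm.
Context (R : realType) (n : nat).
Implicit Types x : 'rV[R]_n.

Lemma enorm_ge0 x : 0 <= enorm x. Proof. exact: sqrtr_ge0. Qed.

Lemma sqr_enorm x : enorm x ^+ 2 = \sum_(i < n) x ord0 i ^+ 2.
Proof. by rewrite sqr_sqrtr// sumr_ge0// => i _; rewrite sqr_ge0. Qed.

Lemma enormZ c x : enorm (c *: x) = `|c| * enorm x.
Proof.
rewrite /enorm -sqrtr_sqr -sqrtrM ?sqr_ge0// mulr_sumr; congr Num.sqrt.
by apply: eq_bigr => i _; rewrite mxE exprMn.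
Qed.

Lemma ler_coord_enorm x i : `|x ord0 i| <= enorm x.
Proof.
rewrite -sqrtr_sqr ler_wsqrtr// (bigD1 i)//= lerDl.
by rewrite sumr_ge0// => j _; rewrite sqr_ge0.
Qed.

Lemma enorm_le_coord x (M : R) : 0 <= M ->
  (forall i, `|x ord0 i| <= M) -> enorm x <= n%:R * M.
Proof.
move=> M0 xM.
rewrite -(@ler_pXn2r _ 2)// ?nnegrE ?enorm_ge0 ?mulr_ge0// sqr_enorm.
apply: (@le_trans _ _ (\sum_(i < n) M ^+ 2)).
  by apply: ler_sum => i _; rewrite -real_normK ?num_real// ler_pXn2r ?nnegrE.
rewrite sumr_const card_ord -(mulr_natl (M ^+ 2)) exprMn.
apply: ler_wpM2r; first exact: sqr_ge0.
by rewrite -natrX ler_nat; case: (n) => // m; rewrite expnS leq_pmulr// expn_gt0.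
Qed.

Lemma measurable_enorm : measurable_fun setT (@enorm R n).
Proof.
apply: (@measurableT_comp _ _ _ _ _ _ (@Num.sqrt R)).
  by apply: continuous_measurable_fun; exact: sqrt_continuous.
apply: measurable_sum => i; apply: measurable_funX; exact: measurable_rV_coord.
Qed.

(** Moving along a coordinate axis changes the Euclidean norm by at most the
    length of the move. *)
Lemma ler_enorm_shift x (h : R) i :
  enorm (h *: delta_mx ord0 i + x) <= `|h| + enorm x.
Proof.
rewrite -(@ler_pXn2r _ 2)// ?nnegrE ?enorm_ge0 ?addr_ge0 ?enorm_ge0//.
rewrite sqrrD !sqr_enorm real_normK ?num_real//.
rewrite (bigD1 i)//= [X in _ <= _ + X](bigD1 i)//= !mxE !eqxx mulr1.
rewrite (eq_bigr (fun j => x ord0 j ^+ 2)); last first.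
  by move=> j ji; rewrite !mxE (negbTE ji) andbF mulr0 add0r.
rewrite addrA lerD2r sqrrD lerD2r lerD2l lerMn2r/=.
rewrite (le_trans (ler_norm _))// normrM; apply: ler_wpM2l => //.
exact: ler_coord_enorm.
Qed.

Lemma enorm_shift x (h : R) i :
  enorm (h *: delta_mx ord0 i + x) ^+ 2 =
  enorm x ^+ 2 + 2 * h * x ord0 i + h ^+ 2.
Proof.
rewrite !sqr_enorm (bigD1 i)//= [in RHS](bigD1 i)//= !mxE !eqxx mulr1.
rewrite (eq_bigr (fun j => x ord0 j ^+ 2)); last first.
  by move=> j ji; rewrite !mxE (negbTE ji) andbF mulr0 add0r.
by ring.
Qed.

Lemma ler_dist_enorm x (h : R) i :
  `|enorm (h *: delta_mx ord0 i + x) - enorm x| <= `|h|.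
Proof.
rewrite ler_norml; apply/andP; split; last first.
  by rewrite lerBlDr; exact: ler_enorm_shift.
have := ler_enorm_shift (h *: delta_mx ord0 i + x) (- h) i.
by rewrite scaleNr addKr normrN; lra.
Qed.

End euclidean_norm.

(** * Volumes of cubes, balls and shells *)

Section cube.
Context (R : realType).

(** The closed cube of half-side [r] centred at the origin. *)
Definition cube n (r : R) : set 'rV[R]_n := [set x | forall i, `|x ord0 i| <= r].

Lemma measurable_cube n (r : R) : measurable (cube r : set 'rV[R]_n).
Proof.
rewrite [X in measurable X](_ : _ = \bigcap_(i in [set: 'I_n])
    ((fun x : 'rV[R]_n => x ord0 i) @^-1` `[- r, r]%classic)); last first.
  apply/seteqP; split => x /= H i.
    by move=> _; rewrite /= in_itv/= -ler_norml.
  by have := H i Logic.I; rewrite /= in_itv/= -ler_norml.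
apply: fin_bigcap_measurable => // i _.
by rewrite -[X in measurable X]setTI; exact: measurable_rV_coord.
Qed.

Lemma lebesgue_cube n (r : R) : 0 <= r ->
  lebesgue_rV R n (cube r) = ((2 * r) ^+ n)%:E.
Proof.
move=> r0; elim: n => [|n IH].
  by rewrite /= diracE mem_set//= => -[].
transitivity ((lebesgue_measure \x lebesgue_rV R n)%E
    (`[- r, r]%classic `*` cube r)).
  rewrite /= /lebesgue_cons /pushforward; congr (_ _).
  apply/seteqP; split => -[t x] /=.
    move=> H; split; first by have := H ord0; rewrite cons_rV0/= in_itv/= ler_norml.
    by move=> i; have := H (lift ord0 i); rewrite cons_rVS.
  move=> [tr xr] i; case: (unliftP ord0 i) => [j|] ->.
    by rewrite cons_rVS/=; exact: xr.
  by rewrite cons_rV0/= ler_norml; move: tr; rewrite in_itv.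
rewrite product_measure1E//=; last exact: measurable_cube.
have -> := lebesgue_measure_itv `[- r, r]; rewrite /= lte_fin.
rewrite IH exprS EFinM; congr (_ * _)%E; case: ifPn => [_|].
  by rewrite -EFinD; congr EFin; ring.
rewrite -leNgt => rr; congr EFin; suff -> : r = 0 by rewrite mulr0.
by lra.
Qed.

End cube.

Section ball.
Context (R : realType) (n : nat) (n0 : (0 < n)%N).
Local Notation mu := (lebesgue_rV R n).

(** The closed Euclidean ball of radius [r] centred at the origin. *)
Definition eball (r : R) : set 'rV[R]_n := [set x | enorm x <= r].

Lemma measurable_eball r : measurable (eball r).
Proof.
have := @measurable_enorm R n measurableT `]-oo, r]%classic.
rewrite setTI; have -> : enorm (N:=n) @^-1` `]-oo, r] = eball r.
  by apply/seteqP; split => x /=; rewrite in_itv.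
by apply; exact: measurable_itv.
Qed.

Lemma subset_eball (r s : R) : r <= s -> eball r `<=` eball s.
Proof. by move=> rs x /le_trans; exact. Qed.

Lemma lebesgue_eball_scale c r : 0 < c ->
  mu (eball (c * r)) = ((c ^+ n)%:E * mu (eball r))%E.
Proof.
move=> c0; rewrite (lebesgue_rV_affine 0 c0); last exact: measurable_eball.
congr (_ * mu _)%E; apply/seteqP; split => x; rewrite /eball /= addr0 enormZ
  gtr0_norm// ler_pM2l//.
Qed.

Lemma lebesgue_eball_fin r : mu (eball r) \is a fin_num.
Proof.
rewrite ge0_fin_numE//.
apply: (@le_lt_trans _ _ (mu (cube `|r|))).
  apply: le_measure; rewrite ?inE; first exact: measurable_eball.
    exact: measurable_cube.
  move=> x xr i; rewrite (le_trans (ler_coord_enorm x i))// (le_trans xr)//.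
  exact: ler_norm.
by rewrite lebesgue_cube// ltry.
Qed.

(** The volume of the Euclidean unit ball. *)
Definition ball_volume : R := fine (mu (eball 1)).

Lemma lebesgue_eball (r : R) : 0 <= r ->
  mu (eball r) = (r ^+ n * ball_volume)%:E.
Proof.
rewrite le_eqVlt => /predU1P[<-|r0].
  (* The ball of radius 0 is its own dilation by 2, so its finite measure is
     multiplied by [2 ^+ n] and must vanish. *)
  have := @lebesgue_eball_scale 2 0; rewrite mulr0 => /(_ ltac:(by [])).
  rewrite expr0n eqn0Ngt n0 mul0r -(fineK (lebesgue_eball_fin 0)) -EFinM.
  move=> [] H; congr EFin; move: H; set m := fine _ => mE.
  have : 2 <= 2 ^+ n :> R by rewrite ler_eXnr// ler1n.
  have : 0 <= m by exact: fine_ge0.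
  nra.
rewrite -[in LHS](mulr1 r) lebesgue_eball_scale// EFinM fineK//.
exact: lebesgue_eball_fin.
Qed.

Lemma ball_volume_gt0 : 0 < ball_volume.
Proof.
have V0 : 0 <= ball_volume by exact: fine_ge0.
rewrite lt_neqAle V0 andbT; apply/eqP => V00.
have : (mu (cube 1) <= mu (eball n%:R))%E.
  apply: le_measure; rewrite ?inE; last 2 first.
    exact: measurable_eball.
    by move=> x /enorm_le_coord; rewrite mulr1; apply.
  exact: measurable_cube.
rewrite lebesgue_cube// lebesgue_eball// -V00 !mulr0 mulr1 lee_fin leNgt.
by rewrite exprn_gt0.
Qed.

Lemma lebesgue_shell (r s : R) : 0 <= r -> r <= s ->
  mu (eball s `\` eball r) = ((s ^+ n - r ^+ n) * ball_volume)%:E.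
Proof.
move=> r0 rs; transitivity (mu (eball s) - mu (eball r))%E; last first.
  by rewrite !lebesgue_eball ?(le_trans r0)// -EFinB mulrBl.
rewrite measureD ?setIidr//.
- exact: subset_eball.
- exact: measurable_eball.
- exact: measurable_eball.
- by have := lebesgue_eball_fin s; rewrite ge0_fin_numE.
Qed.

Lemma sphere_areaE : sphere_area R n = n%:R * ball_volume.
Proof.
rewrite /sphere_area /surface_measure.
have -> : unit_cone (@unit_sphere R n) = eball 1 `\` eball 0.
  apply/seteqP; split => x; rewrite /unit_cone /unit_sphere /eball/=.
    by move=> [/andP[x0 x1] _]; split => //; apply/negP; rewrite -ltNge.
  move=> [x1 /negP]; rewrite -ltNge => x0; rewrite x0 x1; split => //.
  by rewrite enormZ gtr0_norm ?invr_gt0// mulVf// gt_eqF.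
by rewrite lebesgue_shell// expr1n expr0n eqn0Ngt n0 subr0 mul1r -EFinM.
Qed.

Lemma sphere_area_gt0 : 0 < sphere_area R n.
Proof. by rewrite sphere_areaE mulr_gt0 ?ltr0n// ball_volume_gt0. Qed.

Lemma bernoulli_le (d : R) k : 0 <= d <= 1 -> 1 - k%:R * d <= (1 - d) ^+ k.
Proof.
move=> /andP[d0 d1]; elim: k => [|k IH]; first by rewrite mul0r subr0.
rewrite exprS; apply: (@le_trans _ _ ((1 - d) * (1 - k%:R * d))).
  have : 0 <= k%:R :> R by [].
  rewrite -natr1; nra.
by apply: ler_wpM2l => //; rewrite subr_ge0.
Qed.

(** A sphere is contained in the shells of outer radius [r] and inner radius
    [(1 - d) * r], whose volume tends to 0 with [d]. *)
Lemma lebesgue_sphere (r : R) : 0 <= r -> mu [set x | enorm x = r] = 0.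
Proof.
move=> r0; apply/eqP; rewrite eq_le measure_ge0 andbT.
have mS : measurable ([set x | enorm x = r] : set 'rV[R]_n).
  have := @measurable_enorm R n measurableT [set r] (measurable_set1 _).
  by rewrite setTI.
apply/lee_addgt0Pr => e e0; rewrite add0e.
pose D := r ^+ n * ball_volume * n%:R.
have D0 : 0 <= D by rewrite !mulr_ge0// ?exprn_ge0// ltW// ball_volume_gt0.
pose d : R := Num.min 1 (e / (D + 1)).
have d01 : 0 < d <= 1.
  by rewrite ge_min lexx /= lt_min ltr01/= divr_gt0// ltr_wpDl.
have /andP[d0 d1] := d01.
have dD : D * d <= e.
  have : d <= e / (D + 1) by rewrite ge_min lexx orbT.
  by rewrite ler_pdivlMr ?ltr_wpDl// => ?; nra.
case: (ltgtP 0 r) r0 mS => // [{}r0 _ mS|<- _ mS]; last first.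
  apply: (@le_trans _ _ (mu (eball 0))).
    apply: le_measure; rewrite ?inE//; first exact: measurable_eball.
    by move=> x /= x0; rewrite /eball/= x0.
  by rewrite lebesgue_eball// expr0n eqn0Ngt n0 mul0r lee_fin ltW.
apply: (@le_trans _ _ (mu (eball r `\` eball ((1 - d) * r)))).
  apply: le_measure; rewrite ?inE//; first by apply: measurableD; exact: measurable_eball.
  move=> x /= xr; rewrite /eball /= xr; split => //; apply/negP; rewrite -ltNge.
  by rewrite gtr_pMl// ltrBlDr ltrDl.
rewrite lebesgue_shell; last 2 first.
- by rewrite mulr_ge0 ?subr_ge0// ltW.
- by rewrite ler_piMl ?lerBlDr ?lerDl// ltW.
rewrite lee_fin; apply: le_trans dD; rewrite exprMn /D.
have B : 1 - n%:R * d <= (1 - d) ^+ n by apply: bernoulli_le; rewrite d1 ltW.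
have -> : (r ^+ n - (1 - d) ^+ n * r ^+ n) * ball_volume =
  (r ^+ n * ball_volume) * (1 - (1 - d) ^+ n) by ring.
rewrite -[leRHS]mulrA; apply: ler_wpM2l; last by lra.
by rewrite mulr_ge0// ?exprn_ge0 ?ltW// ball_volume_gt0.
Qed.

End ball.

(** * Weak derivatives of Lipschitz functions *)

Section shift.
Context (R : realType) (n : nat).
Local Notation mu := (lebesgue_rV R n).
Local Open Scope ereal_scope.

Lemma measurable_shift (h : 'rV[R]_n) :
  measurable_fun setT (fun x : 'rV[R]_n => x + h)%R.
Proof.
have := @measurable_affine R n 1 h; congr (measurable_fun _ _).
by apply/funext => x; rewrite scale1r.
Qed.

Lemma integral_shift (h : 'rV[R]_n) (f : 'rV[R]_n -> \bar R) :
  measurable_fun setT f -> mu.-integrable setT (fun x => f (x + h)%R) ->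
  \int[mu]_x f (x + h)%R = \int[mu]_x f x.
Proof.
move=> mf intf.
rewrite -(@integral_pushforward _ _ _ _ _ _ (measurable_shift h) mu setT f)//.
apply: eq_measure_integral => [|mf0 A mA _]; first exact: measurable_shift.
rewrite /= /pushforward.
rewrite [RHS](@lebesgue_rV_affine R n 1 h A)// expr1n mul1e; congr (mu _).
by apply/seteqP; split => x /=; rewrite scale1r.
Qed.

End shift.

Section weak_derivative.
Context (R : realType) (n : nat).
Local Notation Rn := 'rV[R]_n.
Local Notation mu := (lebesgue_rV R n).

Lemma compact_cube r : compact (cube r : set Rn).
Proof.
have := @rV_compact R n (fun=> `[- r, r]%classic) (fun=> @segment_compact R _ _).
congr compact; apply/seteqP; split => x /= H i; have := H i;
  by rewrite in_itv/= -ler_norml.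
Qed.

Lemma integrable_cube (f : Rn -> R) (C r : R) : 0 <= r ->
  measurable_fun setT f -> (forall x, `|f x| <= C * \1_(cube r) x) ->
  mu.-integrable setT (EFin \o f).
Proof.
move=> r0 mf fC; apply/integrableP; split; first exact/measurable_EFinP.
apply: (@le_lt_trans _ _ (\int[mu]_x (`|C| * \1_(cube r) x)%:E)%E).
  apply: ge0_le_integral => //.
  - by apply/measurable_EFinP; exact: measurableT_comp.
  - apply/measurable_EFinP; apply: measurable_funM => //.
    by apply: measurable_indic; exact: measurable_cube.
  - move=> x _; rewrite lee_fin (le_trans (fC x))// ler_wpM2r//.
    exact: ler_norm.
under eq_integral do rewrite EFinM.
rewrite ge0_integralZl//; last first.
  by apply/measurable_EFinP; apply: measurable_indic; exact: measurable_cube.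
rewrite integral_indic ?setIT//; last exact: measurable_cube.
apply: lte_mul_pinfty => //.
suff : (lebesgue_rV R n (cube r) < +oo)%E by exact.
by rewrite lebesgue_cube// ltry.
Qed.

Lemma continuous_bounded_cube (f : Rn -> R) r : continuous f ->
  exists2 C : R, 0 <= C & forall x, cube r x -> `|f x| <= C.
Proof.
move=> cf; have /compact_bounded[M [_ HM]] : compact (f @` cube r).
  apply: continuous_compact; last exact: compact_cube.
  exact: continuous_subspaceT.
exists (`|M| + 1) => // x xr; apply: HM; last by exists x.
by rewrite (le_lt_trans (ler_norm _))// ltrDl.
Qed.

Lemma compact_sub_cube (A : set Rn) : compact A ->
  exists2 r : R, 0 <= r & A `<=` cube r.
Proof.
move=> /compact_bounded[M [_ HM]]; exists (`|M| + 1) => // x Ax i.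
apply: le_trans (HM (`|M| + 1) _ _ Ax); last first.
  by rewrite (le_lt_trans (ler_norm _))// ltrDl.
have /mapP[j Hj ->] : `|x ord0 i| \in [seq `|x k.1 k.2| | k : 'I_1 * 'I_n].
  by apply/mapP; exists (ord0, i) => //=; rewrite mem_enum.
by rewrite [leRHS]/Num.norm /= mx_normrE; apply/bigmax_geP; right => /=; exists j.
Qed.

Lemma is_derive_cvg_seq (f : Rn -> R) (x e : Rn) (df : R) (h : R^nat) :
  is_derive x e f df -> (forall k, h k != 0) -> h @ \oo --> 0 ->
  (fun k => (h k)^-1 * (f (h k *: e + x) - f x)) @ \oo --> df.
Proof.
move=> fdf h0 hcvg.
have H : (fun t => t^-1 * (f (t *: e + x) - f x)) @ 0^' --> df.
  rewrite -(@derive_val _ _ _ _ _ _ _ fdf).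
  exact: (@ex_derive _ _ _ _ _ _ _ fdf).
by have [/(_ H h (conj h0 hcvg))] :=
  @cvgr_dnbhsP R (fun t => t^-1 * (f (t *: e + x) - f x)) 0 df.
Qed.

(** The derivative along the line through [x] of direction [e]. *)
Lemma is_derive_line (f : Rn -> R) (x e : Rn) (t : R) :
  derivable f (t *: e + x) e ->
  is_derive t 1 (fun s => f (s *: e + x)) ('D_e f (t *: e + x)).
Proof.
move=> df; have E : (fun h => h^-1 *:
      (((fun s => f (s *: e + x)) \o shift t) (h *: 1) - f (t *: e + x))) =
    (fun h => h^-1 *:
      ((f \o shift (t *: e + x)) (h *: e) - f (t *: e + x))).
  by apply/funext => h /=; rewrite [h *: 1]mulr1 scalerDl addrA.
by split; rewrite /derivable /derive E.
Qed.

Lemma test_function_cube (phi : Rn -> R) : test_function phi ->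
  exists2 r : R, 0 <= r & forall x, ~ cube r x -> phi x = 0.
Proof.
move=> [_ /compact_sub_cube[r r0 Hr]]; exists r => // x xr.
apply/eqP; apply: contra_notT xr => px; apply: Hr; exact: subset_closure.
Qed.

Lemma cube_shift (r h : R) i (x : Rn) :
  cube r x -> cube (r + `|h|) (h *: delta_mx ord0 i + x).
Proof.
move=> xr j; rewrite !mxE (le_trans (ler_normD _ _))// addrC lerD//.
by rewrite normrM ler_piMr//; case: (_ && _); rewrite ?normr1 ?normr0.
Qed.

(** The difference quotients of a test function are bounded uniformly, with
    a common bounded support. *)
Lemma test_function_quotient (phi : Rn -> R) i : test_function phi ->
  exists r C : R, [/\ 0 <= r, 0 <= C & forall (h : R) (x : Rn), 0 < h <= 1 ->
    `|h^-1 * (phi (h *: delta_mx ord0 i + x) - phi x)| <= C * \1_(cube r) x].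
Proof.
move=> tphi; have [r r0 Hr] := test_function_cube tphi.
have [smooth_phi _] := tphi.
have [_ dphi] := smooth_phi [::].
have [cdphi _] := smooth_phi [:: i].
(* The quotient at a point of [cube (r + 1)] is a value of the partial
   derivative at a point at distance at most 1, hence the larger cube. *)
have [C C0 HC] := continuous_bounded_cube (r + 1 + 1) cdphi.
exists (r + 1), C; split => //; first by rewrite addr_ge0.
move=> h x /andP[h0 h1]; set e := delta_mx ord0 i.
rewrite indicE; case: (boolP (x \in cube (r + 1))); last first.
  move=> xr; rewrite mulr0 [phi x]Hr; last first.
    move=> xr'; move/negP: xr; apply; rewrite inE => j.
    by rewrite (le_trans (xr' j))// lerDl.
  rewrite Hr; first by rewrite subrr mulr0 normr0.
  move=> xr'; move/negP: xr; apply; rewrite inE => j.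
  have := cube_shift (- h) i xr'.
  rewrite scaleNr addKr normrN gtr0_norm// => /(_ j).
  by move=> /le_trans; apply; rewrite lerD2l.
rewrite inE mulr1 => xr.
pose g (s : R) := phi (s *: e + x).
have dg (s : R) : is_derive s 1 g ('D_e phi (s *: e + x)).
  by apply: is_derive_line; exact: dphi.
have cg : {within `[0, h], continuous g}.
  by apply: derivable_within_continuous => s _; exact: ex_derive.
have [s sh] := MVT_segment (ltW h0) (fun s _ => dg s) cg.
rewrite /g scale0r add0r subr0 => ->; rewrite mulrCA mulVf ?gt_eqF// mulr1.
apply: HC => j; have := cube_shift s i xr j; move/le_trans; apply.
rewrite lerD2l; move: sh; rewrite in_itv/= => /andP[s0 sh].
by rewrite ger0_norm// (le_trans sh).
Qed.

End weak_derivative.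

Section weak_derivative_lipschitz.
Context (R : realType) (n : nat).
Local Notation Rn := 'rV[R]_n.
Local Notation mu := (lebesgue_rV R n).

Lemma dominated_cvg_cube (f_ : nat -> Rn -> R) (f : Rn -> R) (C r : R) :
  0 <= r ->
  (forall k, measurable_fun setT (f_ k)) -> measurable_fun setT f ->
  {ae mu, forall x, (fun k => f_ k x) @ \oo --> f x} ->
  (forall k x, `|f_ k x| <= C * \1_(cube r) x) ->
  (fun k => \int[mu]_x f_ k x) @ \oo --> \int[mu]_x f x.
Proof.
move=> r0 mf_ mf cf fC.
have ig : mu.-integrable setT (EFin \o (fun x => C * \1_(cube r) x)).
  apply: (@integrable_cube R n _ `|C| r r0).
    by apply: measurable_funM => //; apply: measurable_indic; exact: measurable_cube.
  by move=> x; rewrite normrM ler_wpM2l// ger0_norm.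
have [] := @dominated_convergence _ _ R mu setT measurableT
  (fun k => EFin \o f_ k) (EFin \o f) _ _ _ _ ig _.
- by move=> k; exact/measurable_EFinP.
- exact/measurable_EFinP.
- apply: filterS cf => x cx _.
  by apply: cvg_EFin; [exact: nearW|exact: cx].
- by apply: nearW => x k _ /=; rewrite lee_fin.
move=> If _ cv; rewrite /Rintegral.
apply: fine_cvg; rewrite fineK; last exact: integrable_fin_num.
exact: cv.
Qed.

(** A bounded function that is Lipschitz along a coordinate axis and almost
    everywhere differentiable along it has its pointwise partial derivative as
    weak partial derivative: the difference quotient is moved from the test
    function to [u] by translation invariance, and dominated convergence
    applies on both sides. *)
Lemma weak_partial_lipschitz (i : 'I_n) (u v : Rn -> R) (M K : R) :
  measurable_fun setT u -> measurable_fun setT v ->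
  (forall x, `|u x| <= M) ->
  (forall h x, `|u (h *: delta_mx ord0 i + x) - u x| <= K * `|h|) ->
  {ae mu, forall x, is_derive x (delta_mx ord0 i) u (v x)} ->
  weak_partial i u v.
Proof.
move=> mfu mv uM uK uv phi tphi; set e : Rn := delta_mx ord0 i.
pose h k : R := k.+1%:R^-1.
have h0 k : 0 < h k by rewrite invr_gt0.
have h1 k : h k <= 1 by rewrite invf_le1// ler1n.
have hcvg : h @ \oo --> 0 by exact: cvg_harmonic.
have [sphi _] := tphi; have [r [C [r0 C0 HC]]] := test_function_quotient i tphi.
have [s s0 Hs] := test_function_cube tphi.
have [cphi dphi] := sphi [::]; have [cdphi _] := sphi [:: i].
have [Cp Cp0 HCp] := continuous_bounded_cube s cphi.
have mphi : measurable_fun setT phi by exact: continuous_measurable_rV.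
have mdphi : measurable_fun setT (partial i phi).
  exact: continuous_measurable_rV.
have mshift (f : Rn -> R) (a : R) : measurable_fun setT f ->
    measurable_fun setT (fun x => f (a *: e + x)).
  move=> mf; apply: (measurableT_comp mf).
  have := measurable_shift (a *: e); congr (measurable_fun _ _).
  by apply/funext => x; rewrite addrC.
have phis x : `|phi x| <= Cp * \1_(cube s) x.
  rewrite indicE; case: (boolP (x \in _)) => [|/negP]; rewrite inE => xs.
    by rewrite mulr1; exact: HCp.
  by rewrite Hs// normr0 mulr0.
have M0 : 0 <= M by rewrite (le_trans _ (uM 0)).
have K0 : 0 <= K by have := uK 1 0; rewrite normr1 mulr1; exact: le_trans.
have mq k : measurable_fun setT
    (fun x => (h k)^-1 * (phi (h k *: e + x) - phi x)).
  by apply: measurable_funM => //; apply: measurable_funB => //; exact: mshift.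
have mdu k : measurable_fun setT
    (fun x => (- h k)^-1 * (u (- h k *: e + x) - u x)).
  by apply: measurable_funM => //; apply: measurable_funB => //; exact: mshift.
have mqu k : measurable_fun setT
    (fun x => u x * ((h k)^-1 * (phi (h k *: e + x) - phi x))).
  exact: measurable_funM.
have muq k : measurable_fun setT
    (fun x => ((- h k)^-1 * (u (- h k *: e + x) - u x)) * phi x).
  exact: measurable_funM.
have qub k x : `|u x * ((h k)^-1 * (phi (h k *: e + x) - phi x))| <=
    (M * C) * \1_(cube r) x.
  by rewrite normrM -mulrA ler_pM//; apply: HC; rewrite h0 h1.
have uqb k x : `|((- h k)^-1 * (u (- h k *: e + x) - u x)) * phi x| <=
    (K * Cp) * \1_(cube s) x.
  rewrite normrM -mulrA ler_pM// normrM normfV normrN (gtr0_norm (h0 k)).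
  rewrite mulrC ler_pdivrMr//; have := uK (- h k) x.
  by rewrite normrN (gtr0_norm (h0 k)).
have qcvg : {ae mu, forall x,
    (fun k => u x * ((h k)^-1 * (phi (h k *: e + x) - phi x))) @ \oo -->
    u x * partial i phi x}.
  apply: nearW => x; apply: cvgMr; apply: is_derive_cvg_seq => //.
  - by split => //; exact: dphi.
  - by move=> k; rewrite gt_eqF.
have ucvg : {ae mu, forall x,
    (fun k => (- h k)^-1 * (u (- h k *: e + x) - u x) * phi x) @ \oo -->
    v x * phi x}.
  apply: filterS uv => x ux; apply: cvgMl.
  apply: (@is_derive_cvg_seq _ _ u x e (v x) (fun k => - h k)) => //.
  - by move=> k; rewrite oppr_eq0 gt_eqF.
  - by rewrite -oppr0; exact: cvgN.
have A := dominated_cvg_cube r0 mqu (measurable_funM mfu mdphi) qcvg qub.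
have B := dominated_cvg_cube s0 muq (measurable_funM mv mphi) ucvg uqb.
(* Discrete integration by parts: [u] times the forward quotient of [phi]
   integrates to minus [phi] times the backward quotient of [u]. *)
have E k : \int[mu]_x (u x * ((h k)^-1 * (phi (h k *: e + x) - phi x))) =
   - \int[mu]_x ((- h k)^-1 * (u (- h k *: e + x) - u x) * phi x).
  have mF1 : measurable_fun setT (fun x => u x * phi (h k *: e + x)).
    by apply: measurable_funM => //; exact: mshift.
  have mF2 : measurable_fun setT (fun x => u (- h k *: e + x) * phi x).
    by apply: measurable_funM => //; exact: mshift.
  have mF3 : measurable_fun setT (fun x => u x * phi x) by exact: measurable_funM.
  have I3 : mu.-integrable setT (EFin \o (fun x => u x * phi x)).
    apply: (@integrable_cube R n _ (M * Cp) s) => // x.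
    by rewrite normrM -mulrA ler_pM.
  have I2 : mu.-integrable setT (EFin \o (fun x => u (- h k *: e + x) * phi x)).
    apply: (@integrable_cube R n _ (M * Cp) s) => // x.
    by rewrite normrM -mulrA ler_pM.
  have I1 : mu.-integrable setT (EFin \o (fun x => u x * phi (h k *: e + x))).
    apply: (@integrable_cube R n _ (M * Cp) (s + 1)) => // [|x].
      by rewrite addr_ge0.
    rewrite normrM -mulrA ler_pM//; apply: (le_trans (phis _)).
    apply: ler_wpM2l => //.
    rewrite !indicE ler_nat; case: (boolP (_ \in cube s)) => // /set_mem xs.
    rewrite lt0b; apply/mem_set => j; have := cube_shift (- h k) i xs.
    rewrite scaleNr addKr normrN gtr0_norm// => /(_ j) /le_trans; apply.
    by rewrite lerD2l.
  have E12 : \int[mu]_x (u x * phi (h k *: e + x)) =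
      \int[mu]_x (u (- h k *: e + x) * phi x).
    rewrite /Rintegral; congr fine.
    rewrite -(@integral_shift R n (h k *: e)
      (EFin \o (fun x => u (- h k *: e + x) * phi x))).
    - by apply: eq_integral => x _ /=; rewrite (addrC x) scaleNr addKr.
    - exact/measurable_EFinP.
    - move: I1; congr (mu.-integrable _ _); apply/funext => x /=.
      by rewrite (addrC x) scaleNr addKr.
  have IB (f g : Rn -> R) : mu.-integrable setT (EFin \o f) ->
      mu.-integrable setT (EFin \o g) ->
      mu.-integrable setT (EFin \o (fun x => f x - g x)).
    by move=> If Ig; exact: (integrableB measurableT If Ig).
  transitivity ((h k)^-1 * (\int[mu]_x (u x * phi (h k *: e + x)) -
      \int[mu]_x (u x * phi x))).
    rewrite -RintegralB// -RintegralZl//; last exact: IB.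
    by apply: eq_Rintegral => x _; ring.
  rewrite E12 -RintegralB// -RintegralZl//; last exact: IB.
  rewrite -[RHS]mulN1r -RintegralZl//; last first.
    move: (integrableZl measurableT (- h k)^-1 (integrableB measurableT I2 I3)).
    congr (mu.-integrable _ _); apply/funext => x /=.
    by rewrite -EFinB -EFinM; congr EFin; ring.
  by apply: eq_Rintegral => x _; rewrite invrN; ring.
apply: (cvg_unique _ A) => //.
rewrite (_ : (fun k => _) = (fun k =>
  - \int[mu]_x ((- h k)^-1 * (u (- h k *: e + x) - u x) * phi x))); last first.
  exact/funext.
exact: cvgN.
Qed.

End weak_derivative_lipschitz.

(** * Moser functions *)

Lemma ln_lipschitz (R : realType) (a p q : R) : 0 < a -> a <= p -> a <= q ->
  `|ln p - ln q| <= a^-1 * `|p - q|.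
Proof.
move=> a0; wlog qp : p q / q <= p.
  move=> H ap aq; case: (leP q p) => [|/ltW] h; first exact: H.
  by rewrite distrC [X in _ * X]distrC; exact: H.
move=> ap aq; have p0 := lt_le_trans a0 ap; have q0 := lt_le_trans a0 aq.
rewrite !ger0_norm ?subr_ge0// ?ler_ln ?posrE//.
rewrite -ln_div ?posrE//.
have -> : p / q = 1 + (p - q) / q by field; rewrite gt_eqF.
have pq0 : 0 <= p - q by rewrite subr_ge0.
rewrite (le_trans (le_ln1Dx _))//.
  by rewrite (lt_le_trans _ (divr_ge0 pq0 (ltW q0))).
by rewrite mulrC; apply: ler_wpM2r => //; rewrite lef_pV2 ?posrE.
Qed.

Section moser.
Context (R : realType) (n : nat) (a r : R) (a0 : 0 < a) (ar : a < r).
Local Notation Rn := 'rV[R]_n.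
Local Notation mu := (lebesgue_rV R n).
Implicit Types x : Rn.

Let clip (t : R) : R := Num.max a (Num.min r t).

(** The Moser function (before normalization): it equals [ln (r / a)] on the
    ball of radius [a], [ln (r / |x|)] on the shell between the radii [a] and
    [r], and 0 outside. *)
Definition moser x : R := ln r - ln (Num.max a (Num.min r (enorm x))).

(** The gradient of the Moser function, away from the two spheres where the
    function is not differentiable. *)
Definition moser_grad (i : 'I_n) x : R :=
  - (x ord0 i / enorm x ^+ 2) * \1_(eball r `\` eball a) x.

Let r0 : 0 < r. Proof. exact: lt_trans ar. Qed.

Lemma moser_in x : enorm x <= a -> moser x = ln r - ln a.
Proof.
by move=> xa; rewrite /moser min_r ?max_l// (le_trans xa)// ltW.
Qed.

Lemma moser_out x : r <= enorm x -> moser x = 0.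
Proof. by move=> rx; rewrite /moser min_l// max_r ?subrr// ltW. Qed.

Lemma moser_shell x : a <= enorm x <= r -> moser x = ln r - ln (enorm x).
Proof. by move=> /andP[ax xr]; rewrite /moser min_r ?max_r. Qed.

Let clip_ge t : a <= clip t. Proof. by rewrite /clip le_max lexx. Qed.

Let clip_le t : clip t <= r.
Proof. by rewrite /clip ge_max ge_min lexx (ltW ar). Qed.

Lemma moser_ge0 x : 0 <= moser x.
Proof.
rewrite subr_ge0 ler_ln ?posrE//; first exact: clip_le.
by apply: lt_le_trans (clip_ge _).
Qed.

Lemma moser_le x : moser x <= ln r - ln a.
Proof.
rewrite lerD2l lerN2 ler_ln ?posrE//; first exact: clip_ge.
by apply: lt_le_trans (clip_ge _).
Qed.

Lemma measurable_moser : measurable_fun setT moser.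
Proof.
apply: measurable_funB => //.
apply: (measurableT_comp (@measurable_ln R)).
apply: measurable_maxr => //; apply: measurable_minr => //.
exact: measurable_enorm.
Qed.

Lemma measurable_shell (s t : R) : measurable (eball t `\` eball s : set Rn).
Proof. by apply: measurableD; exact: measurable_eball. Qed.

Lemma measurable_moser_grad i : measurable_fun setT (moser_grad i).
Proof.
apply: measurable_funM; last exact: measurable_indic (measurable_shell _ _).
apply: measurableT_comp => //; apply: measurable_funM.
  exact: measurable_rV_coord.
rewrite (_ : (fun _ => _) = (fun x : Rn => (enorm x ^+ 2) `^ (-1))); last first.
  by apply/funext => x; rewrite powR_inv1// sqr_ge0.
apply: (@measurableT_comp _ _ _ _ _ _ (fun t : R => t `^ (-1))).
  exact: measurable_powR.
by apply: measurable_funX; exact: measurable_enorm.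
Qed.

Lemma moser_lipschitz i (h : R) x :
  `|moser (h *: delta_mx ord0 i + x) - moser x| <= a^-1 * `|h|.
Proof.
rewrite /moser opprB addrC addrA subrK.
apply: (@le_trans _ _
  (a^-1 * `|enorm x - enorm (h *: delta_mx ord0 i + x)|)); last first.
  by apply: ler_wpM2l; [rewrite invr_ge0 ltW|rewrite distrC ler_dist_enorm].
apply: (le_trans (@ln_lipschitz _ a _ _ a0 (clip_ge _) (clip_ge _))).
apply: ler_wpM2l; first by rewrite invr_ge0 ltW.
(* Clipping to [[a, r]] does not increase distances. *)
move: (enorm x) (enorm (h *: delta_mx ord0 i + x)) => s t.
have := ler_norm (s - t); have := ler_norm (t - s); have := normr_ge0 (s - t).
rewrite (distrC t) ler_norml; move: `|s - t| => N N0 ts st.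
rewrite /clip; have [?|?] := leP r t; have [?|?] := leP r s;
  repeat (match goal with
          | |- context [Num.max ?p ?q] => have [?|?] := leP p q
          end);
  apply/andP; split; lra.
Qed.

End moser.

Section moser_derivative.
Context (R : realType) (n : nat) (n0 : (0 < n)%N).
Context (a r : R) (a0 : 0 < a) (ar : a < r).
Local Notation Rn := 'rV[R]_n.
Local Notation mu := (lebesgue_rV R n).
Implicit Types x : Rn.

Lemma is_derive_of_line (f : Rn -> R) x (e : Rn) (df : R) :
  is_derive (0 : R) 1 (fun s : R => f (s *: e + x)) df -> is_derive x e f df.
Proof.
move=> [d1 d2]; have E : (fun h : R => h^-1 *:
      (((fun s : R => f (s *: e + x)) \o shift 0) (h *: 1) - f (0 *: e + x))) =
    (fun h => h^-1 *: ((f \o shift x) (h *: e) - f x)).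
  by apply/funext => h /=; rewrite [h *: 1]mulr1 scale0r addr0 add0r.
by split; [move: d1|move: d2]; rewrite /derivable /derive E.
Qed.

Lemma near_enorm_line i x (d : R) : 0 < d ->
  \forall t \near (0 : R), `|enorm (t *: delta_mx ord0 i + x) - enorm x| < d.
Proof.
move=> d0; apply/nbhs_ballP; exists d => //= t.
rewrite /ball/= sub0r normrN => td.
exact: le_lt_trans (ler_dist_enorm x t i) td.
Qed.

Lemma is_derive_moser_shell i x : a < enorm x < r ->
  is_derive x (delta_mx ord0 i) (@moser R n a r) (- (x ord0 i / enorm x ^+ 2)).
Proof.
move=> /andP[ax xr]; apply: is_derive_of_line.
have x0 : 0 < enorm x by exact: lt_trans ax.
(* [P t] is the squared norm at the point of parameter [t] of the line, and
   [ln |y|] is half of [ln (|y| ^ 2)]. *)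
pose P (t : R) := enorm x ^+ 2 + 2 * x ord0 i * t + t ^+ 2.
have P0 : 0 < P 0 by rewrite /P mulr0 addr0 expr0n/= addr0 exprn_gt0.
have dP : is_derive (0 : R) 1 P (2 * x ord0 i).
  rewrite /P; apply: is_derive_eq; rewrite /= /GRing.scale/=; ring.
have dln : is_derive (P 0) 1 (@ln R) (P 0)^-1 by exact: is_derive1_ln.
have dlnP : is_derive (0 : R) 1 ((@ln R) \o P) ((P 0)^-1 * (2 * x ord0 i)).
  exact: is_derive1_comp.
have dg : is_derive (0 : R) 1 (fun t => ln r - 2^-1 * ln (P t))
    (- (x ord0 i / enorm x ^+ 2)).
  have -> : - (x ord0 i / enorm x ^+ 2) =
      0 - 2^-1 * ((P 0)^-1 * (2 * x ord0 i)).
    by rewrite /P mulr0 addr0 expr0n/= addr0; field; rewrite gt_eqF.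
  have dZ : is_derive (0 : R) 1 (2^-1 \*: ((@ln R) \o P))
      (2^-1 *: ((P 0)^-1 * (2 * x ord0 i))).
    exact: is_deriveZ.
  exact: (is_deriveB (is_derive_cst _ _ _) dZ).
apply: near_eq_is_derive dg.
have [d d0] : exists2 d : R, 0 < d & forall s, `|s - enorm x| < d -> a < s < r.
  exists (Num.min (enorm x - a) (r - enorm x)).
    by rewrite lt_min !subr_gt0 ax.
  move=> s; rewrite lt_min !ltr_norml => /andP[/andP[? ?] /andP[? ?]].
  by apply/andP; lra.
move=> Hd; apply: filterS (near_enorm_line i x d0) => t /Hd /andP[at_ tr].
rewrite moser_shell//; last by rewrite !ltW.
have -> : P t = enorm (t *: delta_mx ord0 i + x) ^+ 2 by rewrite enorm_shift /P; ring.
rewrite lnXn; last exact: lt_trans at_.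
by rewrite -mulr_natr; congr (_ - _); field.
Qed.

Lemma is_derive_moser i x : enorm x != a -> enorm x != r ->
  is_derive x (delta_mx ord0 i) (@moser R n a r) (moser_grad a r i x).
Proof.
move=> xa xr; rewrite /moser_grad indicE.
case: (ltgtP (enorm x) a) xa => // xa _.
  rewrite memNset; last by move=> [_]; apply; rewrite /eball/= ltW.
  rewrite mulr0; apply: is_derive_of_line.
  have dc : is_derive (0 : R) 1 (cst (ln r - ln a) : R -> R) (0 : R).
    exact: is_derive_cst.
  apply: near_eq_is_derive dc.
  have d0 : 0 < a - enorm x by rewrite subr_gt0.
  apply: filterS (near_enorm_line i x d0) => t.
  rewrite ltr_norml => /andP[_ H].
  by rewrite moser_in//; lra.
case: (ltgtP (enorm x) r) xr => // xr _.
  rewrite mem_set; last first.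
    by split; rewrite /eball/=; [exact: ltW|apply/negP; rewrite -ltNge].
  by rewrite mulr1; apply: is_derive_moser_shell; rewrite xa.
rewrite memNset; last by move=> [+ _]; rewrite /eball/= leNgt xr.
rewrite mulr0; apply: is_derive_of_line.
have dc : is_derive (0 : R) 1 (cst 0 : R -> R) (0 : R).
  exact: is_derive_cst.
apply: near_eq_is_derive dc.
have d0 : 0 < enorm x - r by rewrite subr_gt0.
apply: filterS (near_enorm_line i x d0) => t; rewrite ltr_norml => /andP[H _].
by rewrite moser_out//; lra.
Qed.

Lemma ae_is_derive_moser i :
  {ae mu, forall x,
    is_derive x (delta_mx ord0 i) (@moser R n a r) (moser_grad a r i x)}.
Proof.
have mS (s : R) : measurable ([set x | enorm x = s] : set Rn).
  have := @measurable_enorm R n measurableT [set s] (measurable_set1 _).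
  by rewrite setTI.
have NS (s : R) : 0 < s -> mu.-negligible [set x : Rn | enorm x = s].
  move=> s0; exists [set x | enorm x = s]; split => //.
  by apply: lebesgue_sphere => //; exact: ltW.
apply: (@negligibleS _ _ _ mu _ _ _
  (negligibleU (NS a a0) (NS r (lt_trans a0 ar)))).
move=> x /= nd; have [->|xa] := eqVneq (enorm x) a; first by left.
have [->|xr] := eqVneq (enorm x) r; first by right.
by exfalso; apply: nd; exact: is_derive_moser.
Qed.

Lemma weak_partial_moser (c : R) i :
  weak_partial i (fun x => c * moser a r x) (fun x => c * moser_grad a r i x).
Proof.
apply: (@weak_partial_lipschitz R n i _ _ (`|c| * (ln r - ln a)) (`|c| * a^-1)).
- by apply: measurable_funM => //; exact: measurable_moser.
- by apply: measurable_funM => //; exact: measurable_moser_grad.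
- move=> x; rewrite normrM; apply: ler_wpM2l => //.
  by rewrite ger0_norm; [exact: moser_le|exact: moser_ge0].
- move=> h x; rewrite -mulrBr normrM -mulrA; apply: ler_wpM2l => //.
  exact: moser_lipschitz.
- apply: filterS (ae_is_derive_moser i) => x dx.
  exact: (@is_deriveZ _ _ _ _ c x _ _ dx).
Qed.

End moser_derivative.

(** * Energy and norm of the Moser functions *)

Section energy.
Context (R : realType) (n : nat) (n0 : (0 < n)%N).
Local Notation Rn := 'rV[R]_n.
Local Notation mu := (lebesgue_rV R n).
Local Notation vol := (ball_volume R n).

Let shell_density (s t : R) (x : Rn) : R :=
  enorm x ^- n * \1_(eball t `\` eball s) x.

Let shell_density_ge0 s t x : 0 <= shell_density s t x.
Proof. by rewrite mulr_ge0// ?invr_ge0 ?exprn_ge0 ?enorm_ge0. Qed.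

Let measurable_shell_density s t : measurable_fun setT (shell_density s t).
Proof.
apply: measurable_funM; last exact: measurable_indic (measurable_shell _ _).
rewrite (_ : (fun _ => _) = (fun x : Rn => (enorm x ^+ n) `^ (-1))); last first.
  by apply/funext => x; rewrite powR_inv1// exprn_ge0// enorm_ge0.
apply: (@measurableT_comp _ _ _ _ _ _ (fun t : R => t `^ (-1))).
  exact: measurable_powR.
by apply: measurable_funX; exact: measurable_enorm.
Qed.

Lemma integral_scaled_indic (c : R) (A : set Rn) : 0 <= c -> measurable A ->
  (\int[mu]_x (c * \1_A x)%:E = c%:E * mu A)%E.
Proof.
move=> c0 mA; under eq_integral do rewrite EFinM.
rewrite ge0_integralZl//; last by apply/measurable_EFinP; exact: measurable_indic.
by rewrite integral_indic// setIT.
Qed.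

(** Cutting a shell into [k] shells of ratio [q] and bounding the integrand on
    each of them by its value on the inner sphere. *)
Lemma integral_shell_geometric (s q : R) k : 0 < s -> 1 <= q ->
  (\int[mu]_x (enorm x ^- n * \1_(eball (s * q ^+ k) `\` eball s) x)%:E <=
   (k%:R * (q ^+ n - 1) * vol)%:E)%E.
Proof.
move=> s0 q1; have q0 : 0 < q by exact: lt_le_trans q1.
elim: k => [|k IH].
  rewrite expr0 mulr1 mul0r mul0r (eq_integral (cst 0%E)) ?integral0// => x _.
  by rewrite setDv indic0 mulr0.
set t := s * q ^+ k in IH *.
have t0 : 0 < t by rewrite mulr_gt0// exprn_gt0.
have st : s <= t by apply: ler_peMr; [exact: ltW|exact: exprn_ege1].
have -> : s * q ^+ k.+1 = t * q by rewrite exprSr mulrA.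
have tq : t <= t * q by rewrite ler_peMr// ltW.
have mD : measurable (eball (t * q) `\` eball t : set Rn) by exact: measurable_shell.
pose f (x : Rn) := t ^- n * \1_(eball (t * q) `\` eball t) x.
have mf : measurable_fun setT (EFin \o f).
  by apply/measurable_EFinP; apply: measurable_funM => //; exact: measurable_indic.
have f0 x : 0 <= f x by rewrite mulr_ge0// invr_ge0 exprn_ge0// ltW.
apply: (@le_trans _ _ (\int[mu]_x ((shell_density s t x)%:E + (f x)%:E))%E).
  apply: ge0_le_integral => //.
  - by move=> x _; rewrite lee_fin; exact: shell_density_ge0.
  - by apply/measurable_EFinP; exact: measurable_shell_density.
  - by apply/measurable_EFinP; apply: measurable_funD => //; exact/measurable_EFinP.
  - move=> x _; rewrite -EFinD lee_fin /f /shell_density.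
    case: (pselect (eball t x)) => xt.
      rewrite (_ : \1_(eball (t * q) `\` eball s) x =
          \1_(eball t `\` eball s) x :> R).
        by rewrite lerDl f0.
      rewrite !indicE; congr (_%:R); congr nat_of_bool.
      apply/idP/idP => /set_mem[p1 p2]; apply/mem_set; split => //.
      exact: subset_eball xt.
    rewrite (_ : \1_(eball (t * q) `\` eball s) x =
        \1_(eball (t * q) `\` eball t) x :> R); last first.
      rewrite !indicE; congr (_%:R); congr nat_of_bool.
      apply/idP/idP => /set_mem[p1 p2]; apply/mem_set; split => //.
      by apply: contra_not xt; exact: subset_eball.
    apply: ler_wpDl; first exact: shell_density_ge0.
    apply: ler_wpM2r => //; move/negP: xt; rewrite /eball/= -ltNge => tx.
    have x0 := lt_trans t0 tx; rewrite lef_pV2 ?posrE ?exprn_gt0//.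
    by apply: lerXn2r; rewrite ?nnegrE ltW.
rewrite ge0_integralD//; last 3 first.
- by move=> x _; rewrite lee_fin; exact: shell_density_ge0.
- by apply/measurable_EFinP; exact: measurable_shell_density.
- by move=> x _; rewrite lee_fin.
rewrite -natr1 !mulrDl mul1r EFinD; apply: leeD; first exact: IH.
rewrite /f integral_scaled_indic//; last by rewrite invr_ge0 exprn_ge0// ltW.
have -> : mu (eball (t * q) `\` eball t) = ((q ^+ n - 1) * t ^+ n * vol)%:E.
  rewrite lebesgue_shell// ?ltW//; congr EFin; rewrite exprMn; ring.
rewrite -EFinM lee_fin le_eqVlt; apply/orP; left; apply/eqP.
by field; rewrite expf_neq0// gt_eqF.
Qed.

(** Letting the number [k] of shells tend to infinity gives the sharp constant:
    with [y = n * ln (r / a)], [k * (expR (y / k) - 1)] tends to [y]. *)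
Lemma integral_shell_le (a r : R) : 0 < a -> a < r ->
  (\int[mu]_x (enorm x ^- n * \1_(eball r `\` eball a) x)%:E <=
   (sphere_area R n * (ln r - ln a))%:E)%E.
Proof.
move=> a0 ar; have r0 := lt_trans a0 ar.
pose y := n%:R * (ln r - ln a); have y0 : 0 < y.
  by rewrite mulr_gt0// ?ltr0n// subr_gt0 ltr_ln ?posrE.
have V0 := ball_volume_gt0 R n0.
apply/lee_addgt0Pr => e e0; rewrite sphere_areaE//.
(* This [k] makes the error [vol * y ^+ 2 / (k - y)] at most [e]. *)
pose m := Num.truncn (y + vol * y ^+ 2 / e); pose k := m.+1.
have km : y + vol * y ^+ 2 / e < k%:R by exact: truncnS_gt.
have k0 : 0 < k%:R :> R by rewrite ltr0n.
have yk : y < k%:R.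
  by apply: le_lt_trans km; rewrite lerDl; apply: divr_ge0;
    [apply: mulr_ge0; [exact: ltW|exact: sqr_ge0]|exact: ltW].
pose q := expR ((ln r - ln a) / k%:R).
have q1 : 1 <= q.
  by rewrite -expR0 ler_expR divr_ge0// subr_ge0 ler_ln ?posrE// ltW.
have rE : r = a * q ^+ k.
  rewrite -expRM_natl mulrCA divff ?gt_eqF// mulr1 expRB !lnK ?posrE//.
  by rewrite mulrCA divff ?mulr1// gt_eqF.
rewrite {1}rE; apply: (le_trans (integral_shell_geometric k a0 q1)).
rewrite -EFinD lee_fin -expRM_natl -/k.
have -> : n%:R * ((ln r - ln a) / k%:R) = y / k%:R by rewrite mulrA.
have tk : y / k%:R < 1 by rewrite ltr_pdivrMr// mul1r.
have E1 : expR (y / k%:R) <= (1 - y / k%:R)^-1.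
  rewrite -[leLHS]invrK lef_pV2 ?posrE ?invr_gt0 ?expR_gt0 ?subr_gt0//.
  by rewrite -expRN; exact: expR_ge1Dx.
have ky : 0 < k%:R - y by rewrite subr_gt0.
have E2 : k%:R * (expR (y / k%:R) - 1) <= y + y ^+ 2 / (k%:R - y).
  apply: (@le_trans _ _ (k%:R * ((1 - y / k%:R)^-1 - 1))).
    by rewrite ler_pM2l// lerD2r.
  rewrite le_eqVlt; apply/orP; left; apply/eqP; field.
  by rewrite !gt_eqF.
have E3 : vol * (y ^+ 2 / (k%:R - y)) <= e.
  rewrite mulrA ler_pdivrMr// -ler_pdivrMl// lerBrDl.
  by rewrite [e^-1 * _]mulrC ltW.
rewrite [leLHS]mulrC; apply: (le_trans (ler_wpM2l (ltW V0) E2)).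
rewrite mulrDr lerD// /y le_eqVlt; apply/orP; left; apply/eqP; ring.
Qed.

Lemma enorm_moser_grad (a r : R) (x : Rn) : 0 < a ->
  enorm (\row_i moser_grad a r i x) ^+ n =
  enorm x ^- n * \1_(eball r `\` eball a) x.
Proof.
move=> a0; have -> : \row_i moser_grad a r i x =
    (- (enorm x ^- 2 * \1_(eball r `\` eball a) x)) *: x.
  by apply/rowP => i; rewrite !mxE /moser_grad; ring.
rewrite enormZ normrN indicE; case: (boolP (x \in _)) => [/set_mem[_ /negP]|_].
  rewrite /eball/= -ltNge => ax; have x0 := lt_trans a0 ax.
  rewrite !mulr1 ger0_norm ?invr_ge0 ?sqr_ge0// -[RHS]exprVn; congr (_ ^+ _).
  by field; rewrite gt_eqF.
by rewrite !mulr0 normr0 mul0r expr0n eqn0Ngt n0.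
Qed.

Lemma integral_moser_grad_le (a r : R) : 0 < a -> a < r ->
  (\int[mu]_x (enorm (\row_i moser_grad a r i x) ^+ n)%:E <=
   (sphere_area R n * (ln r - ln a))%:E)%E.
Proof.
move=> a0 ar; apply: le_trans (integral_shell_le a0 ar).
by under eq_integral do rewrite enorm_moser_grad//.
Qed.

(** The radius at which the profile [ln (r / |x|)] takes the value [L]. *)
Definition core_radius (r : R) (L : nat) : R := r * expR (- L%:R).

Lemma core_radius_gt0 r L : 0 < r -> 0 < core_radius r L.
Proof. by move=> r0; rewrite mulr_gt0// expR_gt0. Qed.

Lemma ln_core_radius r L : 0 < r -> ln r - ln (core_radius r L) = L%:R.
Proof. by move=> r0; rewrite lnM ?posrE ?expR_gt0// expRK; ring. Qed.

(** The [L^n] norm of the Moser functions stays bounded as the core shrinks,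
    the radius [r] being fixed. Passing from [L] to [L + 1] changes the function
    only on the ball of radius [r * exp (- L)], where it is at most [L + 1], and
    [(L + 1) ^ n * exp (- n * L)] is at most [2 ^ n / 2 ^ L]. *)
Lemma integral_moser_le (r : R) L : (1 < n)%N -> 0 < r ->
  (\int[mu]_x (moser (core_radius r L) r x ^+ n)%:E <=
   (vol * r ^+ n * 2 ^+ n * (2 - 2 * (2^-1) ^+ L))%:E)%E.
Proof.
move=> n1 r0; have V0 := ball_volume_gt0 R n0; elim: L => [|L IH].
  rewrite expr0 mulr1 subrr mulr0 (eq_integral (cst 0%E)) ?integral0// => x _.
  rewrite /moser /core_radius oppr0 expR0 mulr1 max_l ?ge_min ?lexx//.
  by rewrite subrr expr0n eqn0Ngt n0.
pose b := core_radius r L; have b0 : 0 < b by exact: core_radius_gt0.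
have bS : core_radius r L.+1 <= b.
  by rewrite ler_pM2l// ler_expR lerN2 ler_nat.
have br : b <= r by apply: ler_piMr; [exact: ltW|rewrite expR_le1 oppr_le0].
have mr c x : 0 < c -> c <= r -> 0 <= moser c r x :> R.
  move=> c0 cr; rewrite subr_ge0 ler_ln ?posrE//.
    by rewrite ge_max cr ge_min lexx.
  by rewrite (lt_le_trans c0)// le_max lexx.
have bS0 : 0 < core_radius r L.+1 by exact: core_radius_gt0.
pose f (x : Rn) : R := L.+1%:R ^+ n * \1_(eball b) x.
have mf : measurable_fun setT f.
  have mE : measurable (eball b : set Rn) by exact: measurable_eball.
  by apply: measurable_funM => //; exact: measurable_indic.
have f0 x : 0 <= f x by rewrite mulr_ge0// exprn_ge0.
have mM c : measurable_fun setT (fun x : Rn => moser c r x ^+ n).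
  by apply: measurable_funX; exact: measurable_moser.
apply: (@le_trans _ _ (\int[mu]_x ((moser b r x ^+ n)%:E + (f x)%:E))%E).
  apply: ge0_le_integral => //.
  - by move=> x _; rewrite lee_fin exprn_ge0// mr// (le_trans bS).
  - exact/measurable_EFinP.
  - by apply/measurable_EFinP/measurable_funD.
  - move=> x _; rewrite -EFinD lee_fin /f indicE.
    case: (boolP (x \in _)) => [/set_mem|/negP]; rewrite /eball/= => xb.
      rewrite mulr1; apply: ler_wpDl; first by rewrite exprn_ge0// mr.
      rewrite lerXn2r ?nnegrE ?mr// ?(le_trans bS)//.
      rewrite -(ln_core_radius L.+1 r0) lerD2l lerN2 ler_ln ?posrE//.
        by rewrite le_max lexx.
      by rewrite (lt_le_trans bS0)// le_max lexx.
    rewrite mulr0 addr0 /moser.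
    have bx : b < enorm x.
      by rewrite ltNge; apply/negP => h; apply: xb; apply/mem_set.
    have bm : b <= Num.min r (enorm x) by rewrite le_min br ltW.
    by rewrite !max_r// (le_trans bS).
rewrite ge0_integralD//; last 4 first.
- by move=> x _; rewrite lee_fin exprn_ge0// mr.
- exact/measurable_EFinP.
- by move=> x _; rewrite lee_fin.
- exact/measurable_EFinP.
have -> : vol * r ^+ n * 2 ^+ n * (2 - 2 * 2^-1 ^+ L.+1) =
    vol * r ^+ n * 2 ^+ n * (2 - 2 * 2^-1 ^+ L) +
    vol * r ^+ n * 2 ^+ n * 2^-1 ^+ L.
  by rewrite exprS; field.
rewrite EFinD; apply: leeD; first exact: IH.
rewrite /f integral_scaled_indic//; last exact: measurable_eball.
have -> : mu (eball b) = (b ^+ n * vol)%:E by rewrite lebesgue_eball// ltW.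
rewrite -EFinM lee_fin /b /core_radius.
have -> : L.+1%:R ^+ n * ((r * expR (- L%:R)) ^+ n * vol) =
    vol * r ^+ n * (2 ^+ n * (L.+1%:R / 2 * expR (- L%:R)) ^+ n).
  by rewrite !exprMn exprVn; field; rewrite expf_neq0.
rewrite -[leRHS]mulrA ler_wpM2l// ?mulr_ge0 ?exprn_ge0 ?(ltW V0) ?(ltW r0)//.
rewrite ler_wpM2l ?exprn_ge0//; set w := _ * expR _.
have w0 : 0 <= w by rewrite mulr_ge0 ?expR_ge0.
have wL : w <= expR (- L%:R / 2).
  have -> : - L%:R / 2 = L%:R / 2 + - L%:R :> R by field.
  rewrite expRD ler_wpM2r ?expR_ge0//; apply: le_trans (expR_ge1Dx _).
  by rewrite -natr1; lra.
have w1 : w <= 1.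
  by apply: (le_trans wL); rewrite expR_le1 mulNr oppr_le0 divr_ge0.
(* [n] is at least 2. *)
apply: (@le_trans _ _ (w ^+ 2)); first exact: ler_wiXn2l.
apply: (@le_trans _ _ (expR (- L%:R / 2) ^+ 2)).
  by rewrite lerXn2r ?nnegrE ?expR_ge0.
rewrite -expRM_natl (_ : 2%:R * (- L%:R / 2) = - L%:R); last by field.
rewrite expRN exprVn lef_pV2 ?posrE ?expR_gt0 ?exprn_gt0//.
rewrite -(mulr1 L%:R) expRM_natl lerXn2r ?nnegrE ?expR_ge0//.
by apply: le_trans (expR_ge1Dx _); lra.
Qed.

End energy.

(** * Bounds on Phi *)

Section Phi_bounds.
Context (R : realType).

Lemma exp_partial_sum_le (m : nat) (t : R) : 0 <= t ->
  \sum_(k < m) t ^+ k / k`!%:R <= expR t.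
Proof.
move=> t0; have := @nondecreasing_cvgn_le R (series (exp_coeff t)) _ _ m.
rewrite /series/= big_mkord; apply.
  apply: nondecreasing_series => k _ _; rewrite /exp_coeff/=.
  by rewrite divr_ge0 ?exprn_ge0.
exact: is_cvg_series_exp_coeff.
Qed.

Lemma Phi_ge0 N (t : R) : 0 <= t -> 0 <= Phi N t.
Proof. by move=> t0; rewrite subr_ge0 exp_partial_sum_le. Qed.

(** For large [t] the subtracted polynomial is at most half of [expR t]: it is
    at most [2 ^+ N * expR (t / 2)], as seen by expanding [expR (t / 2)]. *)
Lemma Phi_ge_half_exp N (t : R) : (N.+1)%:R * 2 <= t -> expR t / 2 <= Phi N t.
Proof.
move=> Nt; have t0 : 0 <= t by apply: le_trans Nt; rewrite mulr_ge0.
suff H : \sum_(k < N.-1) t ^+ k / k`!%:R <= expR t / 2 by rewrite /Phi; lra.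
apply: (@le_trans _ _ (2 ^+ N * expR (t / 2))).
  apply: (@le_trans _ _ (2 ^+ N * \sum_(k < N.-1) (t / 2) ^+ k / k`!%:R)); last first.
    by rewrite ler_wpM2l ?exprn_ge0// exp_partial_sum_le// divr_ge0.
  rewrite mulr_sumr; apply: ler_sum => k _; rewrite mulrA ler_wpM2r ?invr_ge0//.
  rewrite exprMn mulrCA ler_peMr ?exprn_ge0//.
  rewrite exprVn ler_pdivlMr ?exprn_gt0// mul1r ler_weXn2l ?ler1n//.
  by rewrite (leq_trans (ltnW (ltn_ord k)))// leq_pred.
have -> : expR t = expR (t / 2) * expR (t / 2).
  by rewrite -expRD; congr expR; field.
rewrite -mulrA mulrC ler_wpM2l ?expR_ge0// ler_pdivlMr// -exprSr.
apply: (@le_trans _ _ (expR 1 ^+ N.+1)).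
  by rewrite lerXn2r ?nnegrE ?expR_ge0//; apply: le_trans (expR_ge1Dx _); lra.
by rewrite -expRM_natl mulr1 ler_expR ler_pdivlMr.
Qed.

Lemma measurable_Phi N : measurable_fun setT (@Phi R N).
Proof.
apply: measurable_funB => //.
by apply: measurable_sum => k; apply: measurable_funM.
Qed.

End Phi_bounds.

(** * Normalized Moser functions and blow-up *)

Section normalized_moser.
Context (R : realType) (N : nat) (hN : (2 <= N)%N).
Local Notation Rn := 'rV[R]_N.
Local Notation mu := (lebesgue_rV R N).
Local Notation vol := (ball_volume R N).
Local Notation omega := (sphere_area R N).
Context (r : R) (L : nat) (r0 : 0 < r) (L0 : (0 < L)%N).

Let N0 : (0 < N)%N. Proof. exact: leq_trans hN. Qed.
Let a := core_radius r L.
Let a0 : 0 < a. Proof. exact: core_radius_gt0. Qed.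
Let ar : a < r.
Proof. by rewrite /a /core_radius gtr_pMr// expR_lt1 oppr_lt0 ltr0n. Qed.
(* [w] is the Moser function with core value [L], [G] the length of its
   gradient. *)
Let w : Rn -> R := moser a r.
Let w0 x : 0 <= w x. Proof. exact: moser_ge0. Qed.
Let mw : measurable_fun setT w. Proof. exact: measurable_moser. Qed.
Let G (x : Rn) : R := enorm (\row_i moser_grad a r i x).
Let omega0 : 0 < omega. Proof. exact: sphere_area_gt0. Qed.
Let vol0 : 0 < vol. Proof. exact: ball_volume_gt0. Qed.
Let L0R : 0 < L%:R :> R. Proof. by rewrite ltr0n. Qed.

Let T : R := fine (\int[mu]_x (w x ^+ N)%:E)%E.

(* A bound on [T] that does not depend on [L]. *)
Let D : R := vol * r ^+ N * 2 ^+ N * 2.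

Let ITle : (\int[mu]_x (w x ^+ N)%:E <= D%:E)%E.
Proof.
apply: (le_trans (integral_moser_le N0 L hN r0)); rewrite lee_fin /D.
apply: ler_wpM2l; first by rewrite !mulr_ge0 ?exprn_ge0// ltW.
by rewrite gerBl mulr_ge0// exprn_ge0// invr_ge0.
Qed.

Let IT : (\int[mu]_x (w x ^+ N)%:E = T%:E)%E.
Proof.
rewrite fineK// ge0_fin_numE; first by apply: le_lt_trans ITle _; rewrite ltry.
by apply: integral_ge0 => x _; rewrite lee_fin exprn_ge0.
Qed.

Let T0 : 0 <= T.
Proof. by rewrite fine_ge0// integral_ge0// => x _; rewrite lee_fin exprn_ge0. Qed.

Let TD : T <= D. Proof. by rewrite -lee_fin -IT. Qed.

Let IG : (\int[mu]_x (G x ^+ N)%:E <= (omega * L%:R)%:E)%E.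
Proof.
by apply: (le_trans (integral_moser_grad_le N0 a0 ar)); rewrite ln_core_radius.
Qed.

Let S : R := omega * L%:R + T.
Let S0 : 0 < S. Proof. by rewrite ltr_wpDr// mulr_gt0. Qed.

(** The normalization constant, chosen so that the full Sobolev norm of
    [c * w] is at most 1. *)
Let c : R := S^-1 `^ (N%:R^-1).
Let c0 : 0 <= c. Proof. exact: powR_ge0. Qed.

Let N0R : N%:R != 0 :> R. Proof. by rewrite pnatr_eq0 -lt0n. Qed.

Let cN : c ^+ N = S^-1.
Proof. by rewrite -powR_mulrn// -powRrM mulVf// powRr1// invr_ge0 ltW. Qed.

Let Lnorm_pow (f : Rn -> R) :
  (LN_norm f `^ N%:R = \int[mu]_x (`|f x| ^+ N)%:E)%E.
Proof.
rewrite /LN_norm poweR_Lnorm//; apply: eq_integral => x _.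
by rewrite (_ : `|(EFin \o f) x|%E = `|f x|%:E)// poweR_EFin powR_mulrn.
Qed.

Let mem_Lfun (f : Rn -> R) : measurable_fun setT f ->
  (\int[mu]_x (`|f x| ^+ N)%:E < +oo)%E -> f \in Lfun mu N%:R%:E.
Proof.
move=> mf foo; rewrite inE; apply/andP; split; rewrite inE//.
rewrite /finite_norm; move: foo; rewrite -Lnorm_pow /LN_norm.
suff : forall l : \bar R, (l `^ N%:R < +oo -> l < +oo)%E by apply.
by move=> [l| |]; rewrite ?ltry ?poweRyr ?ltNyr.
Qed.

Let intZ (f : Rn -> R) (k : R) :
  0 <= k -> (forall x, 0 <= f x) -> measurable_fun setT f ->
  (\int[mu]_x (k * f x)%:E = k%:E * \int[mu]_x (f x)%:E)%E.
Proof.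
move=> k0 f0 mf; under eq_integral do rewrite EFinM.
rewrite ge0_integralZl//; first exact/measurable_EFinP.
by move=> x _; rewrite lee_fin.
Qed.

Let Iu : (\int[mu]_x (`|c * w x| ^+ N)%:E = (T / S)%:E)%E.
Proof.
under eq_integral do rewrite normrM !ger0_norm// exprMn cN.
rewrite intZ ?invr_ge0 ?(ltW S0)//; last 2 first.
- by move=> x; rewrite exprn_ge0.
- exact: measurable_funX.
by rewrite IT -EFinM mulrC.
Qed.

Let GN0 x : 0 <= G x. Proof. exact: enorm_ge0. Qed.

Let mG : measurable_fun setT (fun x => G x ^+ N).
Proof.
apply: measurable_funX; apply: (measurableT_comp (@measurable_enorm R N)).
apply: measurable_fun_rVP => i; under eq_fun do rewrite mxE.
exact: measurable_moser_grad.
Qed.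

Let Ig : (\int[mu]_x (`|c * G x| ^+ N)%:E <= (omega * L%:R / S)%:E)%E.
Proof.
under eq_integral do rewrite normrM !ger0_norm// exprMn cN.
rewrite intZ ?invr_ge0 ?(ltW S0)//; last first.
  by move=> x; rewrite exprn_ge0.
by rewrite mulrC EFinM lee_wpmul2l// lee_fin invr_ge0 ltW.
Qed.

Let u_Lfun : (fun x => c * w x) \in Lfun mu N%:R%:E.
Proof. by apply: mem_Lfun; [exact: measurable_funM|rewrite Iu ltry]. Qed.

Let g_Lfun i : (fun x => c * moser_grad a r i x) \in Lfun mu N%:R%:E.
Proof.
have mg : measurable_fun setT (fun x : Rn => c * moser_grad a r i x).
  by apply: measurable_funM => //; exact: measurable_moser_grad.
apply: mem_Lfun => //.
apply: (@le_lt_trans _ _ (omega * L%:R / S)%:E); last by rewrite ltry.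
apply: le_trans Ig; apply: ge0_le_integral => //.
- by apply/measurable_EFinP; apply: measurable_funX; exact: measurableT_comp.
- apply/measurable_EFinP; rewrite (_ : (fun _ => _) = (fun x => c ^+ N * G x ^+ N)).
    exact: measurable_funM.
  by apply/funext => x; rewrite normrM !ger0_norm// exprMn.
- move=> x _; rewrite lee_fin lerXn2r ?nnegrE// normrM [leRHS]normrM ler_wpM2l//.
  rewrite (ger0_norm (GN0 x)); have := ler_coord_enorm (\row_i moser_grad a r i x) i.
  by rewrite mxE.
Qed.

(** The normalized Moser function, as an element of [W1N]. *)
Definition moser_W1N : W1N R N :=
  {| W1N_fun := fun x => c * w x;
     W1N_grad := fun i x => c * moser_grad a r i x;
     W1N_fun_Lfun := u_Lfun;
     W1N_grad_Lfun := g_Lfun;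
     W1N_weak_grad := weak_partial_moser N0 a0 ar c |}.

Lemma moser_W1N_norm_le1 : (W1N_norm moser_W1N <= 1)%E.
Proof.
have Gle : (LN_norm (grad_norm moser_W1N) `^ N%:R <= (omega * L%:R / S)%:E)%E.
  rewrite Lnorm_pow; apply: le_trans Ig; rewrite le_eqVlt; apply/orP; left.
  apply/eqP; apply: eq_integral => x _; congr (`| _ | ^+ _)%:E; rewrite /grad_norm /G.
  rewrite (_ : \row_i _ = c *: \row_i moser_grad a r i x).
    by rewrite enormZ ger0_norm.
  by apply/rowP => i; rewrite !mxE.
have ule : (LN_norm moser_W1N `^ N%:R = (T / S)%:E)%E by rewrite Lnorm_pow Iu.
rewrite /W1N_norm ule -[leRHS](poweR1r N%:R^-1).
have sum1 : (LN_norm (grad_norm moser_W1N) `^ N%:R + (T / S)%:E <= 1)%E.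
  apply: (@le_trans _ _ ((omega * L%:R / S)%:E + (T / S)%:E)%E).
    exact: leeD2r.
  by rewrite -EFinD -mulrDl divff// gt_eqF.
have T1 : (0 <= (T / S)%:E)%E by rewrite lee_fin divr_ge0// ltW.
apply: (gt0_ler_poweR _ _ _ sum1); first by rewrite invr_ge0.
- by rewrite in_itv/= leey andbT adde_ge0// poweR_ge0.
- by rewrite in_itv/= leey andbT lee01.
Qed.

(* The [N]-th power of the [L^N] norm of the normalized function. *)
Let tau : R := T / S.

Let tau01 : 0 <= tau < 1.
Proof.
rewrite divr_ge0 ?(ltW S0)//= ltr_pdivrMr// mul1r /S ltrDr.
by rewrite mulr_gt0.
Qed.

Lemma moser_LN_norm : fine (LN_norm moser_W1N) ^+ N = tau.
Proof.
have : (LN_norm moser_W1N `^ N%:R = tau%:E)%E by rewrite Lnorm_pow Iu.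
have := Lnorm_ge0 mu (N%:R%:E) (EFin \o moser_W1N); rewrite -/(LN_norm _).
case: (LN_norm _) => [l| |] //; last by rewrite poweRyr.
by rewrite lee_fin => l0; rewrite poweR_EFin powR_mulrn// => -[].
Qed.

(** On the core the argument of [Phi] is [N * L] times
    [((1 - tau) * (1 + tau)) ^ (1 / (N - 1))]; a power with exponent at most 1
    of a number in [[0, 1]] is at least that number. *)
Lemma moser_exponent_ge x : enorm x <= a ->
  N%:R * L%:R * (1 - tau ^+ 2) <=
  betaN R N * (1 + 1 * fine (LN_norm moser_W1N) ^+ N) `^ (N.-1%:R^-1)
    * `|moser_W1N x| `^ (N%:R / N.-1%:R).
Proof.
move=> xa; rewrite moser_LN_norm mul1r /betaN /= /w moser_in// ln_core_radius//.
have /andP[t0 t1] := tau01.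
have N10 : N.-1%:R != 0 :> R by rewrite pnatr_eq0; case: (N) hN => [|[]].
rewrite ger0_norm; last by rewrite mulr_ge0.
have -> : (c * L%:R) `^ (N%:R / N.-1%:R) = (S^-1 * L%:R ^+ N) `^ (N.-1%:R^-1).
  by rewrite powRrM powR_mulrn ?mulr_ge0// exprMn cN.
have S10 : 0 <= S^-1 * L%:R ^+ N by rewrite mulr_ge0 ?exprn_ge0// invr_ge0 ltW.
rewrite -!mulrA -powRM//; last by rewrite addr_ge0.
rewrite -powRM ?(ltW omega0)//; last by rewrite mulr_ge0// addr_ge0.
have -> : omega * ((1 + tau) * (S^-1 * L%:R ^+ N)) = L%:R ^+ N.-1 * (1 - tau ^+ 2).
  have E : omega * L%:R / S = 1 - tau.
    by rewrite /tau /S; field; exact: lt0r_neq0 S0.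
  have -> : L%:R ^+ N = L%:R * L%:R ^+ N.-1 :> R by rewrite -exprS prednK.
  have -> : omega * ((1 + tau) * (S^-1 * (L%:R * L%:R ^+ N.-1))) =
    (omega * L%:R / S) * ((1 + tau) * L%:R ^+ N.-1) by ring.
  by rewrite E; ring.
have t2 : 0 < 1 - tau ^+ 2 <= 1.
  by rewrite subr_gt0 gerBl sqr_ge0 andbT expr_lt1.
have /andP[t2p _] := t2.
rewrite powRM ?exprn_ge0// ?(ltW t2p)//.
rewrite -(powR_mulrn N.-1 (ltW L0R)) -powRrM divff// powRr1//.
rewrite ler_wpM2l// ler_wpM2l//; apply: ger1_powR => //.
by case: (N) hN => [|[|k]]//= _; rewrite invf_le1 ?ler1n ?ltr0n.
Qed.

Lemma tau_le : tau <= D / (omega * L%:R).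
Proof.
rewrite /tau ler_pdivrMr// -mulrA mulrC -mulrA ler_pdivlMl ?mulr_gt0//.
have := TD; have := T0; have : 0 < omega * L%:R by rewrite mulr_gt0.
by rewrite /S; nra.
Qed.

(** If the loss in the exponent is at most 1, the core alone contributes a
    fixed multiple of [r ^+ N] to the functional. *)
Lemma moser_functional_ge : (3 < L)%N -> N%:R * D ^+ 2 <= omega ^+ 2 * L%:R ->
  ((r ^+ N * vol * (expR (-1) / 2))%:E <= MT_functional (betaN R N) 1 moser_W1N)%E.
Proof.
move=> L3 DL.
have NLt : N%:R * L%:R * tau ^+ 2 <= 1.
  have /andP[t0 _] := tau01.
  apply: (@le_trans _ _ (N%:R * L%:R * (D / (omega * L%:R)) ^+ 2)).
    by rewrite ler_wpM2l ?mulr_ge0// lerXn2r ?nnegrE// ?(le_trans t0)// tau_le.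
  have -> : N%:R * L%:R * (D / (omega * L%:R)) ^+ 2 =
      (N%:R * D ^+ 2) / (omega ^+ 2 * L%:R).
    by field; rewrite !gt_eqF.
  by rewrite ler_pdivrMr ?mul1r// mulr_gt0// exprn_gt0.
set E := fun x : Rn =>
  betaN R N * (1 + 1 * fine (LN_norm moser_W1N) ^+ N) `^ (N.-1%:R^-1)
    * `|moser_W1N x| `^ (N%:R / N.-1%:R).
have bet0 : 0 <= betaN R N by rewrite mulr_ge0// powR_ge0.
have E0 x : 0 <= E x by rewrite !mulr_ge0// powR_ge0.
have mE : measurable_fun setT E.
  apply: measurable_funM => //.
  apply: (@measurableT_comp _ _ _ _ _ _ (fun t : R => t `^ (N%:R / N.-1%:R))).
    exact: measurable_powR.
  by apply: measurableT_comp => //; exact: measurable_funM.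
have mP : measurable_fun setT (fun x => (Phi N (E x))%:E).
  by apply/measurable_EFinP; apply: (measurableT_comp (@measurable_Phi R N)).
have mB : measurable (eball a : set Rn) by exact: measurable_eball.
rewrite /MT_functional -/E.
apply: (@le_trans _ _ (\int[mu]_(x in eball a) (Phi N (E x))%:E)%E); last first.
  by apply: ge0_subset_integral => // x _; rewrite lee_fin Phi_ge0.
apply: (@le_trans _ _
  (\int[mu]_(x in eball a) (expR (N%:R * L%:R - 1) / 2)%:E)%E).
  have -> : (\int[mu]_(x in eball a) (expR (N%:R * L%:R - 1) / 2)%:E =
      (expR (N%:R * L%:R - 1) / 2 * (a ^+ N * vol))%:E)%E.
    rewrite integral_cst// [RHS]EFinM; congr (_ * _)%E.
    by rewrite -(@lebesgue_eball R N N0 a)// ltW.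
  rewrite lee_fin le_eqVlt; apply/orP; left; apply/eqP.
  rewrite /a /core_radius exprMn -expRM_natl expRD.
  have -> : expR (N%:R * - L%:R) = (expR (N%:R * L%:R))^-1 :> R.
    by rewrite mulrN expRN.
  by field; rewrite gt_eqF// expR_gt0.
apply: ge0_le_integral => //.
- exact: measurable_funTS.
- move=> x xa; rewrite lee_fin.
  have EL : N%:R * L%:R - 1 <= E x.
    by have := moser_exponent_ge xa; rewrite -/(E x); lra.
  apply: (@le_trans _ _ (expR (E x) / 2)).
    by rewrite ler_wpM2r// ler_expR.
  apply: Phi_ge_half_exp; apply: le_trans EL.
  have : 4 <= L%:R :> R by rewrite ler_nat.
  have : 2 <= N%:R :> R by rewrite ler_nat.
  by rewrite -natr1; nra.
Qed.

End normalized_moser.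

Theorem theorem1p2 (R : realType) (N : nat) (hN : (2 <= N)%N) :
  MT N (betaN R N) 1%R = (+oo)%E :> \bar R.
Proof.
have N0 : (0 < N)%N by exact: leq_trans hN.
have vol0 := ball_volume_gt0 R N0; have om0 := sphere_area_gt0 R N0.
have k0 : 0 < ball_volume R N * (expR (-1) / 2).
  by rewrite mulr_gt0// divr_gt0// expR_gt0.
apply/eqyP => A A0.
(* The radius makes the lower bound [r ^+ N * vol * (expR (-1) / 2)] exceed
   [A]; then [L] is taken large enough for the loss in the exponent to be at
   most 1. *)
pose r := A / (ball_volume R N * (expR (-1) / 2)) + 1.
have r1 : 1 <= r by rewrite lerDr divr_ge0 ?ltW.
have r0 : 0 < r by exact: lt_le_trans r1.
pose D := ball_volume R N * r ^+ N * 2 ^+ N * 2.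
pose L := (4 + (Num.truncn (N%:R * D ^+ 2 / sphere_area R N ^+ 2)).+1)%N.
have L0 : (0 < L)%N by [].
have L3 : (3 < L)%N by [].
have DL : N%:R * D ^+ 2 <= sphere_area R N ^+ 2 * L%:R.
  rewrite [leRHS]mulrC -ler_pdivrMr ?exprn_gt0// /L natrD ler_wpDl//.
  exact/ltW/truncnS_gt.
apply: le_trans (ereal_sup_ubound _); last first.
  by exists (moser_W1N hN r0 L0) => //; exact: moser_W1N_norm_le1.
apply: le_trans (moser_functional_ge hN r0 L0 L3 DL); rewrite lee_fin.
rewrite -mulrA -ler_pdivrMr//; apply: (@le_trans _ _ r); first by rewrite lerDl.
by apply: ler_eXnr.
Qed.
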